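(* Let $X,Y$ be Banach spaces and let $\Phi,\Phi^N:X\times Y\to\mathbb{R}$, $N\in\mathbb{N}$. Fix $y\in Y$ and write $\Phi(u)=\Phi(u;y)$, $\Phi^N(u)=\Phi^N(u;y)$. Assume that the probability measures $\mu$ and $\mu^N$ are both absolutely continuous with respect to $\mu_0$, given by $$\frac{d\mu}{d\mu_0}(u)=\frac1Z\exp(-\Phi(u)),\quad Z=\int_X\exp(-\Phi(u))\,d\mu_0(u),$$ $$\frac{d\mu^N}{d\mu_0}(u)=\frac1{Z^N}\exp(-\Phi^N(u)),\quad Z^N=\int_X\exp(-\Phi^N(u))\,d\mu_0(u).$$ Suppose that $\Phi$ and $\Phi^N$ satisfy the following two conditions, uniformly in $N$ (i.e. with constants $\alpha_1,M,K$ independent of $N$), where $\Psi$ stands for $\Phi$ or any $\Phi^N$: (i) there is $\alpha_1>0$ and for every $r>0$ an $M\in\mathbb{R}$ such that $\Psi(u;y)\ge M-\alpha_1\|u\|_X$ for all $u\in X$ and all $y\in Y$ with $\|y\|_Y<r$; (ii) for every $r>0$ there is $K=K(r)>0$ such that $\Psi(u;y)\le K$ for all $u\in X$, $y\in Y$ with $\max\{\|u\|_X,\|y\|_Y\}<r$. Suppose further that there exist $\alpha_3\ge0$ and $C\in\mathbb{R}$ such that $$|\Phi(u)-\Phi^N(u)|\le\exp(\alpha_3\|u\|_X+C)\,\psi(N),$$ where $\psi(N)\to0$ as $N\to\infty$. Suppose that for some $t<\infty$ the space $C^t=C^t(\mathbb{T}^d)$ is continuously embedded in $X$, with embedding constant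 $c_e$: $\|u\|_X\le c_e\|u\|_{C^t}$. Let $\mu_0$ be a $(\kappa,X^{s,q})$ measure with $1\le q<\infty$, $s>t+\frac dq$ and $\kappa>2\,c_e\,r^*(\alpha_1+2\alpha_3)$, where $r^*=r^*(s,t,d,q)$ is the constant defined in the context. Then there exists a constant $C_0$ independent of $N$ such that $$d_{\mathrm{Hell}}(\mu,\mu^N)\le C_0\,\psi(N).$$
   Context: $\mathbb{T}^d=(0,1]^d$ is the $d$-dimensional torus, $d\le3$. Wavelet basis: $\{\psi_l\}_{l\ge1}$ is a $\varrho$-regular orthonormal wavelet basis of $L^2(\mathbb{T}^d)$ with $\varrho>s$, i.e. the periodification of a wavelet basis of $L^2(\mathbb{R}^d)$ whose scaling function and mother wavelets $\bar\psi_m$ ($m=1,\dots,2^d-1$) are $\varrho$-regular; a function $f$ is $\varrho$-regular if $f\in C^\varrho$ and for every integer $m\in\mathbb{N}$ there is $C_m$ with $|\partial^\alpha f(x)|\le C_m(1+|x|)^{-m}$ for all multi-indices $|\alpha|\le\varrho$. The basis is ordered by increasing scale: $\psi_1$ is the (periodized) scaling function and, for $j\ge0$, the $\psi_l$ with $2^{jd}<l\le2^{(j+1)d}$ enumerate the scale-$j$ functions $2^{jd/2}\sum_{n\in\mathbb{Z}^d}\bar\psi_m(2^j(x-n)-k)$, $1\le m\le 2^d-1$, $k\in\{0,\dots,2^j-1\}^d$. (These basis functions are unrelated to the rate function $\psi(N)$.) Prior: a $(\kappa,X^{s,q})$ measure ($\kappa>0$) is the law of the random function $u=\sum_{l=1}^\infty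 l^{-(\frac sd+\frac12-\frac1q)}(\frac1\kappa)^{\frac1q}\xi_l\psi_l$, where $\{\xi_l\}$ are real-valued i.i.d. with density proportional to $\exp(-\frac12|x|^q)$. (Here $\|f\|_{X^{s,q}}=(\sum_l l^{sq/d+q/2-1}|f_l|^q)^{1/q}$ for $f=\sum_l f_l\psi_l$.) Norm: $C^t$ is the Hölder space, identified with $B^t_{\infty,\infty}(\mathbb{T}^d)$, with norm $\|f\|_{C^t}=\sup_{l} l^{\frac td+\frac12}|f_l|$ for $f=\sum_l f_l\psi_l$. Hellinger metric: $d_{\mathrm{Hell}}(\mu,\mu')=\sqrt{\frac12\int\left(\sqrt{\frac{d\mu}{d\nu}}-\sqrt{\frac{d\mu'}{d\nu}}\right)^2d\nu}$ for any reference measure $\nu$ with respect to which $\mu,\mu'$ are absolutely continuous. Constant $r^*$: let $c_d=2\pi^{d/2}/\Gamma(d/2)$, $c_0=\int_{\mathbb{R}^d}\exp(-\frac12|x|^q)\,dx$, $c_{01}=c_d^{-1}\int_{\mathbb{R}^d}e^{-|x|/2}\,dx$. Let $r_1=r_1(s,t,d,q)>0$ be a number such that $$\int_{r_1}^\infty x^{(d-k)(\frac{s-t}{d}-\frac1q)}\exp\left(-\tfrac12x^{\frac{s-t}{d}-\frac1q}\right)dx<\frac{c_{01}}{4(d+1)}\,\frac{1}{2^{k+1}\binom dk},\qquad k=0,\dots,d,$$ and let $c_{q,d}=(2^d q\,c_0/c_d)^{1/(d-q+1)}$ if $1\le q<1+\frac34$, and $c_{q,d}=\max\{1,2^{d+2}q\,c_0/c_d\}$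 if $q\ge1+\frac34$. Then $r^*=(\ln2)\max\{r_1,c_{q,d}\}$. *)

(* Defs.v *)
From HB Require Import structures.
From mathcomp Require Import all_boot all_order all_algebra.
From mathcomp Require Import all_classical all_reals all_analysis.

Set Implicit Arguments.
Unset Strict Implicit.
Unset Printing Implicit Defensive.
Import Order.TTheory GRing.Theory Num.Theory.
Import numFieldNormedType.Exports.
Local Open Scope classical_set_scope.
Local Open Scope ring_scope.

Lemma sigma_finite_prod d1 d2 (T1 : measurableType d1) (T2 : measurableType d2)
    (R : realType) (m1 : {sigma_finite_measure set T1 -> \bar R})
    (m2 : {sigma_finite_measure set T2 -> \bar R}) :
  sigma_finite setT (m1 \x m2)%E.
Proof.
have /sigma_finiteP[F [TF ndF Foo]] := sigma_finiteT m1.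
have /sigma_finiteP[G [TG ndG Goo]] := sigma_finiteT m2.
exists (fun n => F n `*` G n).
  rewrite -setXTT TF TG predeqE => -[x y]; split.
    move=> [/= [n _ Fnx] [k _ Gky]]; exists (maxn n k) => //; split.
    - by move: x Fnx; exact/subsetPset/ndF/leq_maxl.
    - by move: y Gky; exact/subsetPset/ndG/leq_maxr.
  by move=> [n _ []/= ? ?]; split; exists n.
move=> k; have [? ?] := Foo k; have [? ?] := Goo k.
split; first exact: measurableX.
by rewrite product_measure1E// lte_mul_pinfty// ge0_fin_numE.
Qed.

Section cons_measure.
Local Open Scope ereal_scope.
Context (R : realType) (d : nat).
Variable mu : {sigma_finite_measure set (d.-tuple R) -> \bar R}.

Definition tcons (p : R * d.-tuple R) : d.+1.-tuple R := [tuple of p.1 :: p.2].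

Lemma measurable_tcons : measurable_fun [set: R * d.-tuple R] tcons.
Proof. exact: (measurable_cons measurable_fst measurable_snd). Qed.

Definition mcons : set (d.+1.-tuple R) -> \bar R :=
  pushforward (@lebesgue_measure R \x mu) tcons.

Let mcons0 : mcons set0 = 0.
Proof. by rewrite /mcons /pushforward preimage_set0 measure0. Qed.

Let mcons_ge0 A : 0 <= mcons A.
Proof. exact: (measure_ge0 (lebesgue_measure \x mu)). Qed.

Let mcons_sigma_additive : semi_sigma_additive mcons.
Proof.
move=> F mF tF mUF; rewrite /mcons /pushforward preimage_bigcup.
apply: measure_semi_sigma_additive.
- by move=> n; rewrite -[X in measurable X]setTI; exact: measurable_tcons.
- apply/trivIsetP => /= i j _ _ ij; rewrite -preimage_setI.
  by move/trivIsetP : tF => /(_ _ _ _ _ ij) ->//; rewrite preimage_set0.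
- rewrite -preimage_bigcup -[X in measurable X]setTI.
  exact: measurable_tcons.
Qed.

HB.instance Definition _ := isMeasure.Build _ _ _ mcons
  mcons0 mcons_ge0 mcons_sigma_additive.

Let uncons (x : d.+1.-tuple R) : R * d.-tuple R :=
  (thead x, [tuple of behead x]).

Let measurable_uncons : measurable_fun [set: d.+1.-tuple R] uncons.
Proof.
apply: measurable_fun_pair; first exact: measurable_tnth.
exact: measurable_behead.
Qed.

Let mcons_sigma_finite : sigma_finite setT mcons.
Proof.
have [F UF mF] : sigma_finite setT (@lebesgue_measure R \x mu).
  exact: sigma_finite_prod.
exists (fun n => uncons @^-1` F n).
  by rewrite -preimage_bigcup -UF preimage_setT.
move=> n; have [mFn Fnoo] := mF n; split.
  by rewrite -[X in measurable X]setTI; exact: measurable_uncons.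
rewrite /mcons /pushforward; rewrite (_ : _ @^-1` _ = F n)//.
apply/seteqP; split=> -[a b] /=; rewrite /uncons /tcons theadE.
- by congr (F n (_, _)); apply/val_inj.
- by congr (F n (_, _)); apply/val_inj.
Qed.

HB.instance Definition _ := Measure_isSigmaFinite.Build _ _ _ mcons
  mcons_sigma_finite.

End cons_measure.

Fixpoint lebesgue_Rd (R : realType) (d : nat) :
    {sigma_finite_measure set (d.-tuple R) -> \bar R} :=
  match d with
  | 0 => \d_([tuple] : 0.-tuple R)
  | d'.+1 => mcons (lebesgue_Rd R d')
  end.

Section euclidean_space.
Context (R : realType) (d : nat).
Local Notation E := 'rV[R]_d.

(* Points of R^d are row vectors; integrals are taken over d.-tuple R, which
   carries the product sigma-algebra, and [vec] identifies the two. *)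
Definition vec (x : d.-tuple R) : E := \row_i tnth x i.

(* The library norm on 'rV[R]_d is the maximum norm. *)
Definition enorm (x : E) : R := Num.sqrt (\sum_i x ord0 i ^+ 2).

Definition unit_cube : set (d.-tuple R) :=
  [set x | forall i, 0 < tnth x i <= 1].

Definition inner (D : set (d.-tuple R)) (f g : E -> R) : R :=
  \int[lebesgue_Rd R d]_(x in D) (f (vec x) * g (vec x)).

Definition square_integrable (D : set (d.-tuple R)) (f : E -> R) : Prop :=
  measurable_fun D (f \o vec) /\
  (\int[lebesgue_Rd R d]_(x in D) (f (vec x) ^+ 2)%:E < +oo)%E.

(* Orthonormal family in L^2(D) whose linear span is dense. *)
Definition orthonormal_basis (D : set (d.-tuple R)) (I : eqType)
    (e : I -> E -> R) : Prop :=
  [/\ forall i, square_integrable D (e i),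
      forall i j, inner D (e i) (e j) = (i == j)%:R
    & forall f, square_integrable D f -> forall eps : R, 0 < eps ->
      exists (J : seq I) (c : I -> R),
        (\int[lebesgue_Rd R d]_(x in D)
           ((f (vec x) - \sum_(i <- J) c i * e i (vec x)) ^+ 2)%:E < eps%:E)%E].

(* The multi-index alpha is given as the list of the directions of
   differentiation, so that |alpha| is the size of the list. *)
Fixpoint partial (alpha : seq 'I_d) (f : E -> R) : E -> R :=
  match alpha with
  | [::] => f
  | i :: beta => fun x => 'D_(delta_mx ord0 i) (partial beta f) x
  end.

Definition C_class (n : nat) (f : E -> R) : Prop :=
  forall alpha : seq 'I_d, (size alpha <= n)%N ->
    continuous (partial alpha f) /\
    ((size alpha < n)%N ->
     forall i x, derivable (partial alpha f) x (delta_mx ord0 i)).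

Definition regular (rho : nat) (f : E -> R) : Prop :=
  C_class rho f /\
  forall m : nat, exists C : R, forall alpha : seq 'I_d,
    (size alpha <= rho)%N ->
    forall x, `|partial alpha f x| <= C * (1 + enorm x) ^- m.

Definition periodic (f : E -> R) : Prop :=
  forall i x, f (x + delta_mx ord0 i) = f x.

Definition int_vec (n : 'rV[int]_d) : E := map_mx intr n.

(* g(x) is the sum over n in Z^d of f(x - n), as the limit of the sums over
   the boxes [-N, N]^d; for a rapidly decreasing f the series converges
   absolutely and the order of summation is immaterial. *)
Definition periodization (f g : E -> R) : Prop :=
  forall x, (fun N : nat =>
    \sum_(n : {ffun 'I_d -> 'I_(N.*2.+1)})
       f (x - int_vec (\row_i ((n i : nat)%:Z - N%:Z)))) @ \oo --> g x.

Definition scaled (j : nat) (k : 'rV[int]_d) (f : E -> R) : E -> R :=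
  fun x => 2 `^ ((j * d)%:R / 2) * f ((2 ^+ j) *: x - int_vec k).

(* The translates of the scaling function phi, and the dilated translates of
   the mother wavelets at the scales j >= 0. That this family is an
   orthonormal basis of L^2(R^d) says that phi generates a multiresolution
   analysis of which the psib m are the wavelets. *)
Definition wavelet_system (phi : E -> R) (psib : 'I_((2 ^ d).-1) -> E -> R)
    (i : 'rV[int]_d + (nat * 'I_((2 ^ d).-1) * 'rV[int]_d)) : E -> R :=
  match i with
  | inl k => scaled 0 k phi
  | inr (j, m, k) => scaled j k (psib m)
  end.

(* psi is indexed from 1 and psi 0 is never used. For l < 2^((j+1)d) - 2^(jd),
   sigma l = (m, k) gives the wavelet of scale j that is numbered
   2^(jd) + l + 1. *)
Definition regular_wavelet_basis (rho : nat) (psi : nat -> E -> R) : Prop :=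
  orthonormal_basis unit_cube (fun l => psi l.+1) /\
  exists (phi : E -> R) (psib : 'I_((2 ^ d).-1) -> E -> R),
  [/\ regular rho phi,
      forall m, regular rho (psib m),
      orthonormal_basis setT (wavelet_system phi psib),
      periodization phi (psi 1%N)
    & forall j : nat, exists sigma : 'I_(2 ^ (j.+1 * d) - 2 ^ (j * d)) ->
          'I_((2 ^ d).-1) * {ffun 'I_d -> 'I_(2 ^ j)},
        bijective sigma /\
        forall l, periodization
          (scaled j (\row_i ((sigma l).2 i : nat)%:Z) (psib (sigma l).1))
          (psi (2 ^ (j * d) + l).+1)].

Definition test_function (f : E -> R) : Prop :=
  periodic f /\ forall n, C_class n f.

(* Functionals on the smooth functions on the torus. Those used below are
   pointwise limits of finite combinations of functions, hence linear and
   continuous, i.e. distributions. *)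
Definition functional : Type := {f : E -> R | test_function f} -> R.

Section holder_space.
Variable psi : nat -> E -> R.

(* f = sum_(l >= 1) a_l psi_l in the sense of distributions on the torus, so
   that t <= 0 is allowed below; for t > 0 this is an L^2 expansion. *)
Definition expansion (f : functional) (a : nat -> R) : Prop :=
  forall h, (fun n : nat =>
    \sum_(1 <= l < n.+1) a l * inner unit_cube (psi l) (sval h)) @ \oo --> f h.

Definition weighted_coefs (t : R) (a : nat -> R) : set R :=
  [set l%:R `^ (t / d%:R + 1 / 2) * `|a l| | l in [set l : nat | (0 < l)%N]].

Definition Ct (t : R) : set functional :=
  [set f | exists a, expansion f a /\ has_ubound (weighted_coefs t a)].

(* iota matters only on Ct. The supremum is the C^t norm of f: the bounded
   wavelet coefficients of f are unique when the wavelets are regular enough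
   for t, so quantifying over the expansions chooses nothing. *)
Definition Ct_embedding (t : R) (X : normedModType R) (iota : functional -> X)
    (ce : R) : Prop :=
  [/\ forall (c : R) (f g : functional), Ct t f -> Ct t g ->
        iota (fun h => c * f h + g h) = c *: iota f + iota g,
      forall f g, Ct t f -> Ct t g -> iota f = iota g -> f = g
    & forall f a, expansion f a -> has_ubound (weighted_coefs t a) ->
        `|iota f| <= ce * sup (weighted_coefs t a)].

End holder_space.
End euclidean_space.

Notation borel X := (g_sigma_algebraType (@open X)).

Section probability.
Context (R : realType).

(* Mutual independence of the xi_l, l >= 1. *)
Definition independent_from1 (dO : measure_display) (Omega : measurableType dO)
    (P : probability Omega R) (xi : nat -> {RV P >-> R}) : Prop :=
  forall (J : seq nat) (B : nat -> set R),
    uniq J -> 0%N \notin J -> (forall l, measurable (B l)) ->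
    (P (\bigcap_(l in [set` J]) (xi l @^-1` B l)) =
     \prod_(l <- J) P (xi l @^-1` B l))%E.

Definition exp_power_law (dO : measure_display) (Omega : measurableType dO)
    (P : probability Omega R) (q : R) (x : {RV P >-> R}) : Prop :=
  exists2 c : R, 0 < c & forall A : set R, measurable A ->
    distribution P x A =
    (\int[lebesgue_measure]_(r in A) (c * expR (- (1 / 2 * `|r| `^ q)))%:E)%E.

(* The law on X of the random series u. That u lies in C^t almost surely is
   not part of the definition. *)
Definition besov_measure (d : nat) (psi : nat -> 'rV[R]_d -> R) (s q kappa : R)
    (X : normedModType R) (iota : functional R d -> X)
    (mu0 : probability (borel X) R) : Prop :=
  exists (dO : measure_display) (Omega : measurableType dO)
    (P : probability Omega R) (xi : nat -> {RV P >-> R})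
    (u : Omega -> functional R d),
  [/\ independent_from1 xi,
      forall l, (0 < l)%N -> exp_power_law q (xi l),
      {ae P, forall w, expansion psi (u w) (fun l =>
         l%:R `^ (- (s / d%:R + 1 / 2 - 1 / q)) * (1 / kappa) `^ (1 / q)
         * xi l w)},
      measurable_fun [set: Omega] (iota \o u : Omega -> borel X)
    & forall A : set (borel X), measurable A ->
        mu0 A = P ((iota \o u) @^-1` A)].

Definition has_density (dT : measure_display) (T : measurableType dT)
    (mu mu0 : probability T R) (f : T -> R) : Prop :=
  mu `<< mu0 /\
  ae_eq mu0 setT (Radon_Nikodym (charge_of_finite_measure mu) mu0)
    (fun u => (f u)%:E).

(* The value does not depend on the reference measure nu, as long as nu
   dominates mu and mu'; Radon_Nikodym is -oo when it does not. *)
Definition hellinger (dT : measure_display) (T : measurableType dT)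
    (nu : {sigma_finite_measure set T -> \bar R}) (mu mu' : probability T R) : R :=
  Num.sqrt (1 / 2 * \int[nu]_u
    (Num.sqrt (fine (Radon_Nikodym (charge_of_finite_measure mu) nu u))
     - Num.sqrt (fine (Radon_Nikodym (charge_of_finite_measure mu') nu u))) ^+ 2).

End probability.

Section constants.
Context (R : realType).

Definition Gamma (z : R) : R :=
  \int[lebesgue_measure]_(x in `]0, +oo[) (x `^ (z - 1) * expR (- x)).

Definition c_sphere (d : nat) : R :=
  2 * pi `^ (d%:R / 2) / Gamma (d%:R / 2).

Definition c0 (q : R) (d : nat) : R :=
  \int[lebesgue_Rd R d]_x expR (- (1 / 2 * enorm (vec x) `^ q)).

Definition c01 (d : nat) : R :=
  (c_sphere d)^-1 * \int[lebesgue_Rd R d]_x expR (- (enorm (vec x) / 2)).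

Definition r1_condition (s t : R) (d : nat) (q r1 : R) : Prop :=
  let a := (s - t) / d%:R - 1 / q in
  forall k : nat, (k <= d)%N ->
    (\int[lebesgue_measure]_(x in `]r1, +oo[)
        (x `^ ((d - k)%:R * a) * expR (- (1 / 2 * x `^ a)))%:E
     < (c01 d / (4 * (d.+1)%:R) * (1 / (2 ^+ k.+1 * 'C(d, k)%:R)))%:E)%E.

Definition c_qd (q : R) (d : nat) : R :=
  if q < 1 + 3 / 4
  then (2 ^+ d * q * c0 q d / c_sphere d) `^ (1 / (d%:R - q + 1))
  else Num.max 1 (2 ^+ d.+2 * q * c0 q d / c_sphere d).

Definition r_star (r1 q : R) (d : nat) : R := ln 2 * Num.max r1 (c_qd q d).

End constants.

(* Main.v *)
(* The square roots of the densities f = exp(-Phi)/Z and f_N are nonnegative unit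
   vectors of L^2(mu0), and the distance of two such vectors is at most sqrt 2
   times the distance of the first one to any nonnegative multiple of the
   second. Taking the multiple sqrt (Z_N/Z) gives
     d_Hell^2 <= Z^-1 int (exp(-Phi/2) - exp(-Phi_N/2))^2 dmu0
              <= const psi(N)^2 int exp((alpha1 + 2 alpha3) |u|) dmu0.
   Any dominating nu can be replaced by mu0 here, since f > 0 gives
   mu0 << mu << nu.

   For the exponential moment, |u| <= c_e sup_l X_l a.s. with
   X_l = l^-b kappa^(-1/q) |xi_l|, b = (s - t)/d - 1/q > 0, and
     exp(g X_l) <= exp g + D l^-2 exp((g kappa^(-1/q) + e) |xi_l|).
   The right-hand side is summable in expectation, hence also bounds
   exp(g sup_l X_l). For q > 1 all exponential moments of xi_l are finite; for
   q = 1 one needs g / kappa < 1/2, which follows from the assumption on kappa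
   because r_star >= 1. *)

Require Import Defs.
From HB Require Import structures.
From mathcomp Require Import all_boot all_order all_algebra.
From mathcomp Require Import all_classical all_reals all_analysis.
From mathcomp Require Import measurable_realfun ring lra.
Import Order.TTheory GRing.Theory Num.Theory.
Import numFieldNormedType.Exports.
Local Open Scope classical_set_scope.
Local Open Scope ring_scope.

Set Implicit Arguments.
Unset Strict Implicit.
Unset Printing Implicit Defensive.

(** * The constant r_star for q = 1 *)

Lemma integral_expR_abs (R : realType) (a : R) : 0 < a ->
  (\int[lebesgue_measure]_x (expR (- (a * `|x|)))%:E = (2 / a)%:E)%E.
Proof.
move=> a0.
have cf : continuous (fun x : R => expR (- (a * `|x|))).
  move=> x; apply: continuous_comp; last exact: continuous_expR.
  apply: (@continuousN _ R^o); apply: continuousM; first exact: cst_continuous.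
  exact: norm_continuous.
rewrite ge0_symfun_integralT//; last by move=> x /=; rewrite normrN.
rewrite -set_itvcy; under eq_integral => x.
  rewrite inE/= in_itv/= andbT => x0.
  rewrite (ger0_norm x0).
  over.
have dF x : is_derive x (1 : R) (fun x => - (a^-1 * expR (- (a * x))))
    (expR (- (a * x))).
  have dg : is_derive x (1 : R) (fun x : R => - (a * x)) (- a).
    by apply: is_derive_eq; rewrite /GRing.scale/= mulr1.
  have H := is_deriveN (is_deriveZ a^-1 (is_derive1_comp (is_derive_expR _) dg)).
  apply: (@is_derive_eq _ _ _ _ _ _ _ _ H).
  by rewrite /GRing.scale/=; field; rewrite gt_eqF.
rewrite (@ge0_continuous_FTC2y R (fun x => expR (- (a * x)))
  (fun x => - (a^-1 * expR (- (a * x)))) 0 0)//.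
- by rewrite mulr0 oppr0 expR0 mulr1 -EFinD sub0r opprK -EFinM mulrC.
- apply: continuous_subspaceT => x.
  apply: continuous_comp; last exact: continuous_expR.
  by apply: (@continuousN _ R^o); apply: continuousM => //; exact: cst_continuous.
- rewrite -oppr0 -(mulr0 a^-1); apply: cvgN; apply: cvgMr.
  apply: (@cvg_comp _ _ _ _ (fun z => expR (- z)) _ (pinfty_nbhs R)); last exact: cvgr_expR.
  exact: gt0_cvgMry.
- apply: cvg_at_right_filter.
  apply: (@differentiable_continuous _ _ _ (0 : R) (fun x => - (a^-1 * expR (- (a * x))))).
  exact/derivable1_diffP/ex_derive.
- by move=> x _; rewrite derive1E; exact: derive_val.
Qed.

Lemma measurable_expR_abs (R : realType) (a : R) :
  measurable_fun [set: R] (fun x : R => expR (- (a * `|x|))).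
Proof.
apply: measurableT_comp => //; apply: measurableT_comp => //.
by apply: measurable_funM => //; exact: measurableT_comp.
Qed.

Lemma measurable_prod_expR_abs (R : realType) (a : R) (d : nat) :
  measurable_fun [set: d.-tuple R]
    (fun x => \prod_(i < d) expR (- (a * `|tnth x i|))).
Proof.
apply: measurable_prod => i _.
by apply: (measurableT_comp (@measurable_expR_abs _ a)); exact: measurable_tnth.
Qed.

(** Induction on d by Tonelli, since [lebesgue_Rd] adjoins one coordinate at a time. The integrand
    is exp(-a |x|_1) with the l^1 norm, the comparison function for [c0]. *)
Lemma integral_prod_expR_abs (R : realType) (a : R) (d : nat) : 0 < a ->
  (\int[lebesgue_Rd R d]_x (\prod_(i < d) expR (- (a * `|tnth x i|)))%:E =
   ((2 / a) ^+ d)%:E)%E.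
Proof.
move=> a0; elim: d => [|d IH].
  rewrite /= integral_dirac//=; last first.
    by apply/measurable_EFinP; exact: measurable_prod_expR_abs.
  by rewrite diracE in_setT mul1e big_ord0.
rewrite /=.
pose g (x : d.+1.-tuple R) := (\prod_(i < d.+1) expR (- (a * `|tnth x i|)))%:E.
rewrite (_ : integral _ _ _ =
    \int[pushforward (lebesgue_measure \x lebesgue_Rd R d) (@tcons R d)]_x g x)%E//.
have mg : measurable_fun [set: d.+1.-tuple R] g.
  by apply/measurable_EFinP; exact: measurable_prod_expR_abs.
rewrite ge0_integral_pushforward//; last 2 first.
- exact: measurable_tcons.
- by move=> x _; rewrite lee_fin; apply: prodr_ge0 => i _; exact: expR_ge0.
rewrite preimage_setT fubini_tonelli1//; last 2 first.
- by apply: measurableT_comp => //; exact: measurable_tcons.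
- by move=> x; rewrite lee_fin; apply: prodr_ge0 => i _; exact: expR_ge0.
rewrite (eq_integral (fun x : measurableTypeR R =>
    (expR (- (a * `|x : R|)))%:E * ((2 / a) ^+ d)%:E)%E).
  rewrite ge0_integralZr//; last 2 first.
  - by apply/measurable_EFinP; exact: measurable_expR_abs.
  - by rewrite lee_fin exprn_ge0// divr_ge0// ltW.
  by rewrite integral_expR_abs// -EFinM exprS.
move=> x _; rewrite /fubini_F.
rewrite (eq_integral (fun y : d.-tuple R => (expR (- (a * `|x : R|)))%:E *
    (\prod_(i < d) expR (- (a * `|tnth y i|)))%:E)%E).
  rewrite ge0_integralZl//; last 2 first.
  - by apply/measurable_EFinP; exact: measurable_prod_expR_abs.
  - by move=> y _; rewrite lee_fin; apply: prodr_ge0 => i _; exact: expR_ge0.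
  by rewrite IH.
move=> y _; rewrite /g /= -EFinM big_ord_recl; congr (_ * _)%:E.
by apply: eq_bigr => i _; rewrite tnthS.
Qed.

(** * Lower bounds for Gamma at 1/2, 1 and 3/2 *)

Lemma integral_powR_itv01 (R : realType) (z : R) : 0 < z ->
  (\int[lebesgue_measure]_(x in `]0%R, 1%R]) (x `^ (z - 1))%:E <= z^-1%:E)%E.
Proof.
move=> z0.
(* For z < 1 the integrand is unbounded at 0, so it is integrated over intervals away from 0,
   followed by monotone convergence. *)
pose F (n : nat) : set R := `[n.+1%:R^-1, 1]%classic.
have F0 n : (0 : R) < n.+1%:R^-1 by rewrite invr_gt0 ltr0n.
have UF : `]0, 1]%classic = \bigcup_n F n :> set R.
  apply/seteqP; split=> x /=.
    rewrite in_itv/= => /andP[x0 x1].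
    exists (Num.truncn x^-1) => //; rewrite /F/= in_itv/= x1 andbT.
    rewrite -[leRHS]invrK lef_pV2 ?posrE ?invr_gt0 ?ltr0n//.
    exact/ltW/truncnS_gt.
  move=> [n _]; rewrite /F/= !in_itv/= => /andP[nx ->]; rewrite andbT.
  exact: lt_le_trans nx.
have mpow D : measurable_fun D (fun x : R => (x `^ (z - 1))%:E).
  by apply/measurable_EFinP/measurable_funTS; exact: measurable_powR.
rewrite UF.
apply: (@cvge_le _ \oo _ _ (fun n => \int[lebesgue_measure]_(x in F n) (x `^ (z - 1))%:E)%E).
  near=> n.
  (* The fundamental theorem is applied on a nondegenerate interval, which excludes n = 0. *)
  have n1 : (n.+1%:R^-1 : R) < 1.
    by rewrite invf_lt1 ?ltr0n// ltr1n; near: n; exists 1%N.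
  have dpow (x : R) : 0 < x -> derivable (fun x : R => z^-1 * x `^ z) x 1.
    by move=> x0; apply: derivableM => //; apply: derivable_powR; rewrite in_itv/= x0.
  have cpow (p x : R) : 0 < x -> {for x, continuous (fun x : R => x `^ p)}.
    move=> x0; apply/differentiable_continuous/derivable1_diffP.
    by apply: derivable_powR; rewrite in_itv/= x0.
  rewrite (@continuous_FTC2 R _ (fun x => z^-1 * x `^ z))//.
  - by rewrite -EFinB lee_fin powR1 mulr1 gerBl mulr_ge0 ?powR_ge0// invr_ge0 ltW.
  - apply: continuous_in_subspaceT => x; rewrite inE/= in_itv/= => /andP[nx _].
    exact/cpow/(lt_le_trans (F0 n)).
  - split.
    + by move=> x; rewrite in_itv/= => /andP[nx _]; exact/dpow/(lt_trans (F0 n)).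
    + by apply: cvg_at_right_filter; apply: cvgMr; exact: cpow.
    + by apply: cvg_at_left_filter; apply: cvgMr; exact: cpow.
  - move=> x; rewrite in_itv/= => /andP[nx _].
    have x0 := lt_trans (F0 n) nx.
    rewrite derive1Ml; last by apply: derivable_powR; rewrite in_itv/= x0.
    by rewrite powR_derive1 ?in_itv/= ?x0// mulrA mulVf ?mul1r// gt_eqF.
apply: ge0_nondecreasing_set_cvg_integral.
- move=> m n mn; rewrite /F; apply/subsetPset; apply: subset_itvr.
  by rewrite bnd_simp lef_pV2 ?posrE ?ltr0n// ler_nat.
- by move=> i; exact: measurable_itv.
- by move=> i; exact: mpow.
- by move=> i x _; rewrite lee_fin powR_ge0.
Unshelve. all: by end_near. Qed.

(** [Gamma] is the [fine] part of an extended integral, hence 0 if that integral is +oo; a lower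
    bound therefore rests on finiteness. Near 0 the power is integrable because z > 0, and beyond 1
    it is at most x because z <= 2. *)
Lemma Gamma_integrand_lty (R : realType) (z : R) : 0 < z <= 2 ->
  (\int[lebesgue_measure]_(x in `]0%R, +oo[)
     (x `^ (z - 1) * expR (- x))%:E < +oo)%E.
Proof.
move=> /andP[z0 z2].
have mG D : measurable_fun D (fun x : R => (x `^ (z - 1) * expR (- x))%:E).
  apply/measurable_EFinP/measurable_funTS/measurable_funM.
    exact: measurable_powR.
  exact: measurableT_comp.
have G0 (x : R) : (0 <= (x `^ (z - 1) * expR (- x))%:E)%E.
  by rewrite lee_fin mulr_ge0 ?powR_ge0 ?expR_ge0.
have -> : `]0, +oo[%classic = `]0, 1] `|` `]1, +oo[ :> set R.
  by rewrite (@itv_bndbnd_setU _ _ _ (BRight 1)) ?bnd_simp.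
rewrite ge0_integral_setU//=; last 2 first.
- exact: mG.
- rewrite disj_set2E; apply/eqP; rewrite -subset0 => x [] /=.
  by rewrite !in_itv/= andbT => /andP[_ x1]; rewrite ltNge x1.
apply: lte_add_pinfty.
  apply: le_lt_trans (ltry z^-1); apply: (le_trans _ (integral_powR_itv01 z0)).
  apply: ge0_le_integral => //; first exact: mG.
    by apply/measurable_EFinP/measurable_funTS; exact: measurable_powR.
  move=> x; rewrite /= in_itv/= => /andP[x0 x1].
  rewrite lee_fin ler_piMr ?powR_ge0// -expR0 ler_expR; lra.
(* From 1 + x / 2 <= exp(x / 2) one gets x exp(-x) <= 2 exp(-x / 2). *)
pose g (x : R) := (2%:E * (expR (- (2^-1 * `|x|)))%:E)%E.
apply: (@le_lt_trans _ _ (\int[lebesgue_measure]_x g x)%E); last first.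
  rewrite /g ge0_integralZl//=; last first.
    by apply/measurable_EFinP; exact: measurable_expR_abs.
  by rewrite integral_expR_abs ?invr_gt0// -EFinM ltry.
have mg D : measurable_fun D g.
  apply: measurable_funeM; apply/measurable_EFinP/measurable_funTS.
  exact: measurable_expR_abs.
apply: (@le_trans _ _ (\int[lebesgue_measure]_(x in `]1%R, +oo[) g x)%E).
  apply: ge0_le_integral => //; [exact: mG|exact: mg|].
  move=> x; rewrite /= in_itv/= andbT => x1.
  have x0 : 0 < x by rewrite (lt_trans _ x1).
  rewrite /g -EFinM lee_fin (ger0_norm (ltW x0)).
  have -> : - x = - (2^-1 * x) + - (2^-1 * x) by lra.
  rewrite expRD mulrA ler_wpM2r ?expR_ge0//.
  apply: (@le_trans _ _ (x * expR (- (2^-1 * x)))).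
    rewrite ler_wpM2r ?expR_ge0// ler1_powR; lra.
  rewrite expRN ler_pdivrMr ?expR_gt0//.
  have := expR_ge1Dx (2^-1 * x); lra.
apply: ge0_subset_integral => //; first exact: mg.
by move=> x _; rewrite mule_ge0// lee_fin expR_ge0.
Qed.

(* [(a x + b) exp(-x)] is an antiderivative of [(a - b - a x) exp(-x)]. *)
Lemma Gamma_ge_affine (R : realType) (z a b : R) : 0 < z <= 2 ->
  (forall x, 0 < x <= 3 -> 0 <= a - b - a * x <= x `^ (z - 1)) ->
  (a * 3 + b) * expR (- 3) - b <= Gamma z.
Proof.
move=> z02 ab.
pose f x : R := (a - b - a * x) * expR (- x).
have cf : continuous f.
  move=> x.
  apply: (@continuousM _ R^o (fun x => a - b - a * x) (fun x => expR (- x))).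
    apply: (@continuousB _ R^o); first exact: cst_continuous.
    by apply: (@continuousM _ R^o) => //; exact: cst_continuous.
  apply: continuous_comp; last exact: continuous_expR.
  exact: (@continuousN _ R^o).
have mf D : measurable_fun D (EFin \o f).
  apply/measurable_EFinP/measurable_funTS; exact: continuous_measurable_fun.
have mG D : measurable_fun D (fun x : R => (x `^ (z - 1) * expR (- x))%:E).
  apply/measurable_EFinP/measurable_funTS/measurable_funM.
    exact: measurable_powR.
  exact: measurableT_comp.
have dF x : is_derive x (1 : R) (fun x => (a * x + b) * expR (- x)) (f x).
  have de : is_derive x (1 : R) (fun x : R => - x) (- 1).
    exact: is_deriveN.
  have dl : is_derive x (1 : R) (fun x : R => a * x + b) a.
    by apply: is_derive_eq; rewrite /GRing.scale/= mulr1 addr0.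
  have H := is_deriveM dl (is_derive1_comp (is_derive_expR _) de).
  apply: (@is_derive_eq _ _ _ _ _ _ _ _ H).
  by rewrite /f /GRing.scale/=; ring.
have cF (x : R) : {for x, continuous (fun x => (a * x + b) * expR (- x))}.
  exact/differentiable_continuous/derivable1_diffP/ex_derive.
have I03 : (\int[lebesgue_measure]_(x in `[0%R, 3%R]) (f x)%:E =
    ((a * 3 + b) * expR (- 3) - b)%:E)%E.
  rewrite (@continuous_FTC2 R f (fun x => (a * x + b) * expR (- x)))//.
  - by rewrite -EFinB oppr0 expR0 mulr0 add0r mulr1.
  - exact: continuous_subspaceT.
  - split; first by move=> x _; exact: ex_derive.
      by apply: cvg_at_right_filter; exact: cF.
    by apply: cvg_at_left_filter; exact: cF.
  - by move=> x _; rewrite derive1E; exact: derive_val.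
rewrite -lee_fin /Gamma /Rintegral fineK; last first.
  rewrite ge0_fin_numE; first exact: Gamma_integrand_lty.
  by apply: integral_ge0 => x _; rewrite lee_fin mulr_ge0 ?powR_ge0 ?expR_ge0.
rewrite -I03 -integral_itv_obnd_cbnd//.
apply: (@le_trans _ _ (\int[lebesgue_measure]_(x in `]0%R, 3%R])
    (x `^ (z - 1) * expR (- x))%:E)%E).
  apply: ge0_le_integral => //.
  - move=> x; rewrite /= in_itv/= => /ab /andP[x0 _].
    by rewrite lee_fin mulr_ge0 ?expR_ge0.
  - exact: mf.
  - exact: mG.
  - move=> x; rewrite /= in_itv/= => /ab /andP[_ x1].
    by rewrite lee_fin ler_wpM2r ?expR_ge0.
apply: ge0_subset_integral => //; first exact: mG.
  by move=> x _; rewrite lee_fin mulr_ge0 ?powR_ge0 ?expR_ge0.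
exact: subset_itvl.
Qed.

(** Each dimension has its affine minorant of x^(d/2 - 1) on (0, 3]: the tangent (3 - x) / 2 at 1
    for d = 1, then 1 - x / 3 for d = 2 and x / 2 for d = 3. The first two bounds follow from
    exp(-3) > 0, the third from exp(-3) <= 1/8. *)
Lemma Gamma_half_ge (R : realType) (d : nat) : (0 < d <= 3)%N ->
  2 / 2 ^+ d <= Gamma (d%:R / 2 : R).
Proof.
have e0 : 0 < expR (-3) :> R := expR_gt0 _.
move=> /andP[d0 d3]; have : d \in [:: 1; 2; 3]%N.
  by case: d d0 d3 => [|[|[|[|?]]]].
rewrite !inE => /or3P[] /eqP ->.
- apply: (@le_trans _ _ ((1 / 2 * 3 + - 1) * expR (- 3) - - 1)); first by lra.
  apply: Gamma_ge_affine => [|x /andP[x0 x3]]; first by lra.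
  apply/andP; split; first lra.
  have -> : 1%:R / 2 - 1 = - 2^-1 :> R by lra.
  rewrite powRN (powR12_sqrt (ltW x0)).
  have s0 : 0 < Num.sqrt x by rewrite sqrtr_gt0.
  rewrite -[leRHS]mul1r ler_pdivlMr//.
  have := @sqr_sqrtr _ x (ltW x0).
  set u := Num.sqrt x in s0 * => ux.
  (* With u = sqrt x the claim (3 - u^2) u / 2 <= 1 reads u^3 - 3 u + 2 >= 0, and this cubic factors
     as shown. *)
  have : 0 <= (u - 1) ^+ 2 * (u + 2) by rewrite mulr_ge0 ?sqr_ge0//; lra.
  by nra.
- apply: (@le_trans _ _ ((1 / 3 * 3 + - (2 / 3)) * expR (- 3) - - (2 / 3))).
    by lra.
  apply: Gamma_ge_affine => [|x /andP[x0 x3]]; first by lra.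
  have -> : 2%:R / 2 - 1 = 0 :> R by lra.
  by rewrite powRr0; lra.
- have e8 : expR (- 3) <= 8^-1 :> R.
    rewrite expRN lef_pV2 ?posrE ?expR_gt0//.
    have -> : 3 = 3%:R * 1 :> R by rewrite mulr1.
    rewrite expRM_natl; apply: (@le_trans _ _ ((1 + 1) ^+ 3)); first by lra.
    by rewrite lerXn2r ?nnegrE ?expR_ge0 ?expR_ge1Dx//; lra.
  apply: (@le_trans _ _ ((- (1 / 2) * 3 + - (1 / 2)) * expR (- 3) - - (1 / 2))).
    by lra.
  apply: Gamma_ge_affine => [|x /andP[x0 x3]]; first by lra.
  have -> : 3%:R / 2 - 1 = 2^-1 :> R by lra.
  rewrite (powR12_sqrt (ltW x0)).
  have s0 : 0 < Num.sqrt x by rewrite sqrtr_gt0.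
  have := @sqr_sqrtr _ x (ltW x0).
  set u := Num.sqrt x in s0 * => ux.
  apply/andP; split; first lra.
  suff : u <= 2 by nra.
  by rewrite -(@ler_pXn2r _ 2) ?nnegrE//; lra.
Qed.

(** The upper bound is 2 * 2^d * (2^d / 2), from pi <= 4 and the lower bound on Gamma. It is chosen
    to match the lower bound 4^d of [c0]. *)
Lemma c_sphere_bounds (R : realType) (d : nat) : (0 < d <= 3)%N ->
  0 < c_sphere R d <= 4 ^+ d.
Proof.
move=> d03; have G := Gamma_half_ge R d03.
have G0 : 0 < Gamma (d%:R / 2 : R).
  by apply: lt_le_trans G; rewrite divr_gt0// exprn_gt0.
rewrite /c_sphere; apply/andP; split.
  by rewrite divr_gt0// mulr_gt0// powR_gt0// pi_gt0.
rewrite ler_pdivrMr//.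
have pi2 : pi `^ (d%:R / 2) <= 2 ^+ d :> R.
  rewrite mulrC powRrM powR12_sqrt ?pi_ge0// powR_mulrn ?sqrtr_ge0//.
  rewrite lerXn2r ?nnegrE ?sqrtr_ge0// -[leRHS]ger0_norm// -sqrtr_sqr.
  rewrite ler_wsqrtr//; have := @pihalf_lt2 R; lra.
apply: (@le_trans _ _ (4 ^+ d * (2 / 2 ^+ d))); last by rewrite ler_wpM2l// exprn_ge0.
have -> : 4 = 2 * 2 :> R by lra.
have e0 : 2 ^+ d != 0 :> R by rewrite expf_neq0.
have -> : (2 * 2) ^+ d * (2 / 2 ^+ d) = 2 * 2 ^+ d :> R by rewrite exprMn; field.
by rewrite ler_wpM2l.
Qed.

(** * Comparison of the Euclidean and l^1 norms, and the integral [c0] at q = 1 *)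

Lemma sum_sqr_le (R : realType) (d : nat) (a : 'I_d -> R) :
  (forall i, 0 <= a i) -> \sum_i a i ^+ 2 <= (\sum_i a i) ^+ 2.
Proof.
elim: d a => [|d IH] a a0; first by rewrite !big_ord0 expr0n.
rewrite !big_ord_recl.
have S0 : 0 <= \sum_(i < d) a (lift ord0 i) by apply: sumr_ge0.
have := IH (fun i => a (lift ord0 i)) (fun i => a0 _).
have := a0 ord0; nra.
Qed.

Lemma enorm_le_sum (R : realType) (d : nat) (x : d.-tuple R) :
  enorm (vec x) <= \sum_i `|tnth x i|.
Proof.
rewrite -[leRHS]ger0_norm ?sumr_ge0// -sqrtr_sqr ler_wsqrtr//.
apply: le_trans (sum_sqr_le _) => //.
by apply: ler_sum => i _; rewrite mxE real_normK// num_real.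
Qed.

Lemma norm_tnth_le_enorm (R : realType) (d : nat) (x : d.-tuple R) i :
  `|tnth x i| <= enorm (vec x).
Proof.
rewrite -sqrtr_sqr ler_wsqrtr// (bigD1 i)//= mxE lerDl.
by apply: sumr_ge0 => j _; rewrite sqr_ge0.
Qed.

Lemma measurable_enorm_vec (R : realType) (d : nat) :
  measurable_fun [set: d.-tuple R] (fun x => enorm (vec x)).
Proof.
apply: (measurableT_comp (continuous_measurable_fun (@sqrt_continuous R))).
apply: measurable_sum => i; apply: measurable_funX.
under eq_fun do rewrite mxE.
exact: measurable_tnth.
Qed.

(** The Euclidean norm is at most the l^1 norm, so the integrand is at least the product of the
    exp(-|x_i| / 2), whose integral is 4^d. *)
Lemma c0_1_ge (R : realType) (d : nat) : (0 < d)%N -> 4 ^+ d <= c0 (1 : R) d.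
Proof.
move=> d0.
have mh : measurable_fun [set: d.-tuple R]
    (fun x => (expR (- (1 / 2 * enorm (vec x) `^ 1)))%:E).
  apply/measurable_EFinP; apply: measurableT_comp => //.
  apply: measurableT_comp => //; apply: measurable_funM => //.
  apply: (measurableT_comp (measurable_powR 1)); exact: measurable_enorm_vec.
have h0 (x : d.-tuple R) : (0 <= (expR (- (1 / 2 * enorm (vec x) `^ 1)))%:E)%E.
  by rewrite lee_fin expR_ge0.
have mp (a : R) : measurable_fun [set: d.-tuple R]
    (fun x => (\prod_(i < d) expR (- (a * `|tnth x i|)))%:E).
  by apply/measurable_EFinP; exact: measurable_prod_expR_abs.
have prodE (a : R) (x : d.-tuple R) :
    \prod_(i < d) expR (- (a * `|tnth x i|)) = expR (- (a * \sum_i `|tnth x i|)).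
  by rewrite -expR_sum sumrN mulr_sumr.
rewrite -lee_fin /c0 /Rintegral fineK; last first.
  rewrite ge0_fin_numE; last exact: integral_ge0.
  (* Finiteness: |x|_1 <= d |x| bounds the integrand by the product of the exp(-|x_i| / (2 d)). *)
  have dR : 0 < (2 * d%:R)^-1 :> R by rewrite invr_gt0 mulr_gt0// ltr0n.
  apply: le_lt_trans (ltry ((2 / (2 * d%:R)^-1) ^+ d)).
  rewrite -integral_prod_expR_abs//; apply: ge0_le_integral => // x _.
  rewrite lee_fin prodE ler_expR lerN2 powRr1 ?sqrtr_ge0//.
  rewrite ler_pdivrMl ?mulr_gt0 ?ltr0n//.
  have -> : 2 * d%:R * (1 / 2 * enorm (vec x)) = d%:R * enorm (vec x) by lra.
  apply: le_trans (ler_sum _ (fun i _ => norm_tnth_le_enorm x i)) _.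
  by rewrite sumr_const card_ord mulr_natl.
have -> : 4 = 2 / 2^-1 :> R by rewrite invrK; lra.
rewrite -integral_prod_expR_abs ?invr_gt0//; apply: ge0_le_integral => //.
  by move=> x _; rewrite lee_fin prodE expR_ge0.
move=> x _; rewrite lee_fin prodE ler_expR lerN2 powRr1 ?sqrtr_ge0// mul1r.
by rewrite ler_pM2l ?invr_gt0// enorm_le_sum.
Qed.

(* [c0 1 d >= 4^d >= c_sphere] gives [c_qd 1 d >= 2], and [ln 2 >= 1 / 2]. *)
Lemma r_star1_ge1 (R : realType) (d : nat) (r1 : R) : (0 < d <= 3)%N ->
  1 <= r_star r1 1 d.
Proof.
move=> d03; have /andP[d0 d3] := d03.
have /andP[s0 s4] := c_sphere_bounds R d03.
have c4 := c0_1_ge R d0.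
have cqd : 2 <= c_qd (1 : R) d.
  rewrite /c_qd ifT; last by lra.
  (* At q = 1 the exponent 1 / (d - q + 1) is 1 / d. *)
  rewrite mulr1 -addrA addNr addr0 mul1r.
  have dR : d%:R != 0 :> R by rewrite pnatr_eq0 -lt0n.
  have root2 : 2 = (2 ^+ d) `^ (d%:R^-1) :> R.
    by rewrite -powR_mulrn// -powRrM mulfV// powRr1.
  have q2 : 2 ^+ d <= 2 ^+ d * c0 (1 : R) d / c_sphere R d.
    rewrite -mulrA ler_peMr ?exprn_ge0// ler_pdivlMr// mul1r.
    exact: le_trans c4.
  rewrite [leLHS]root2 ge0_ler_powR ?nnegrE ?invr_ge0 ?exprn_ge0//.
  by apply: le_trans q2; rewrite exprn_ge0.
(* Equivalently exp(1/2) <= 2, which follows from exp(-1/2) >= 1 - 1/2. *)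
have ln2 : 1 / 2 <= ln 2 :> R.
  rewrite -ler_expR lnK ?posrE//.
  have := expR_ge1Dx (- (1 / 2) : R); rewrite expRN => h.
  have e0 := expR_gt0 (1 / 2 : R).
  rewrite -[expR _]invrK -[leRHS]invrK lef_pV2 ?posrE ?invr_gt0//; lra.
apply: (@le_trans _ _ (1 / 2 * 2)); first lra.
rewrite /r_star; apply: ler_pM => //.
by rewrite le_max cqd orbT.
Qed.

(** * Exponential moments of the prior *)

(** A density given set by set yields absolute continuity and agrees a.e. with the Radon-Nikodym
    derivative, for which the change of variables is known. *)
Lemma ge0_integral_density (d : measure_display) (T : measurableType d)
    (R : realType) (nu : {finite_measure set T -> \bar R})
    (mu : {sigma_finite_measure set T -> \bar R}) (g : T -> \bar R) :
  (forall x, 0 <= g x)%E -> measurable_fun setT g ->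
  (forall A, measurable A -> nu A = \int[mu]_(x in A) g x)%E ->
  forall f : T -> \bar R, (forall x, 0 <= f x)%E -> measurable_fun setT f ->
  (\int[nu]_x f x = \int[mu]_x (f x * g x))%E.
Proof.
move=> g0 mg nuE f f0 mf.
have numu : nu `<< mu.
  apply/null_content_dominatesP => A mA muA0; rewrite nuE//.
  apply: null_set_integral => //; exact: measurable_funS mg.
have SFint := Radon_Nikodym_SigmaFinite.f_integrable numu.
rewrite -(Radon_Nikodym_SigmaFinite.change_of_variables numu)//.
apply: ge0_ae_eq_integral => //.
- by apply: emeasurable_funM => //; exact: measurable_int SFint.
- exact: emeasurable_funM.
- by move=> x _; rewrite mule_ge0// Radon_Nikodym_SigmaFinite.f_ge0.
- by move=> x _; rewrite mule_ge0.
apply: ae_eqe_mul2l; apply: integral_ae_eq => // A _ mA.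
by rewrite -nuE// (Radon_Nikodym_SigmaFinite.f_integral numu).
Qed.

Lemma exp_power_dominates_linear (R : realType) (q g : R) : 1 <= q ->
  (q = 1 -> g < 1 / 2) ->
  exists2 e : R, 0 < e &
    exists B : R, forall r, 0 <= r -> g * r - 1 / 2 * r `^ q <= B - e * r.
Proof.
move=> q1 gq; have [q1E|qN1] := eqVneq q 1.
  exists (1 / 2 - g); first by rewrite subr_gt0; exact: gq.
  by exists 0 => r r0; rewrite q1E powRr1//; lra.
have q0 : 0 < q - 1 by rewrite subr_gt0 lt_neqAle eq_sym qN1.
(* For r >= T one has r^q >= M r >= 2 (g + 1) r, so the left-hand side is at most -r. For r <= T, (g
   + 1) r <= M T. The maximum with 1 keeps M positive for negative g. *)
pose M : R := Num.max 1 (2 * (g + 1)); pose T := M `^ (q - 1)^-1.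
have M0 : 0 < M by rewrite lt_max ltr01.
exists 1 => //; exists (M * T) => r r0.
have T0 : 0 <= T by exact: powR_ge0.
have Mg : g + 1 <= M / 2 by rewrite ler_pdivlMr// mulrC le_max lexx orbT.
have M1 : 1 <= M by rewrite le_max lexx.
have [rT|Tr] := leP r T.
  have : 0 <= r `^ q by exact: powR_ge0.
  by nra.
have : M * r <= r `^ q.
  rewrite -(mulr_powRB1 r0) ?(lt_le_trans ltr01)// mulrC ler_wpM2l//.
  have -> : M = T `^ (q - 1) by rewrite -powRrM mulVf ?gt_eqF// powRr1 ?ltW.
  by rewrite ge0_ler_powR ?nnegrE// ltW.
by nra.
Qed.

(** K is chosen before the random variable, so that one bound serves all the xi_l in the series
    below. *)
Lemma exp_power_law_exp_moment (R : realType) (q g : R) : 1 <= q ->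
  (q = 1 -> g < 1 / 2) ->
  exists K : R, forall (dO : measure_display) (Omega : measurableType dO)
    (P : probability Omega R) (x : {RV P >-> R}), exp_power_law q x ->
  (\int[P]_w (expR (g * `|x w|))%:E <= K%:E)%E.
Proof.
move=> q1 gq; have [e e0 [B HB]] := exp_power_dominates_linear q1 gq.
(* The factors bound the normalising constant c, the constant in the linear domination, and the
   integral of exp(-e |r|). *)
exists (expR (1 / 2) * expR B * (2 / e)) => dO Omega P x [c c0 xE].
pose G (r : R) := (c * expR (- (1 / 2 * `|r| `^ q)))%:E.
have mnorm : measurable_fun [set: R] (@Num.norm R R) by exact: normr_measurable.
have mG : measurable_fun [set: R] G.
  apply/measurable_EFinP; apply: measurable_funM => //.
  apply: measurableT_comp => //; apply: measurableT_comp => //.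
  apply: measurable_funM => //.
  exact: (measurableT_comp (measurable_powR q) mnorm).
have G0 r : (0 <= G r)%E by rewrite lee_fin mulr_ge0 ?expR_ge0// ltW.
(* On [0, 1] the density is at least c exp(-1/2), while its total mass is 1. *)
have c_le : c <= expR (1 / 2).
  suff : c * expR (- (1 / 2)) <= 1.
    by rewrite expRN ler_pdivrMr ?expR_gt0// [1 * expR _]mul1r.
  have xT : (\int[lebesgue_measure]_r G r = 1)%E.
    by rewrite -xE//; exact: probability_setT.
  rewrite -lee_fin -xT.
  apply: (@le_trans _ _ (\int[lebesgue_measure]_(r in `[0%R, 1%R]) G r)%E); last first.
    by apply: ge0_subset_integral => //.
  apply: (@le_trans _ _ (\int[lebesgue_measure]_(r in `[0%R, 1%R])
      (cst (c * expR (- (1 / 2)))%:E r))%E).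
    rewrite integral_cst//= lebesgue_measure_itv/= lte_fin ltr01.
    by rewrite oppr0 adde0 mule1.
  apply: ge0_le_integral => //.
  - by move=> r _; rewrite lee_fin mulr_ge0 ?expR_ge0// ltW.
  - exact: measurable_funS mG.
  - move=> r; rewrite /= in_itv/= => /andP[r0 r1].
    rewrite lee_fin ler_wpM2l ?(ltW c0)// ler_expR lerN2.
    rewrite -[leRHS]mulr1 ler_wpM2l// ger0_norm//.
    rewrite [leRHS](_ : 1 = 1 `^ q); last by rewrite powR1.
    by rewrite ge0_ler_powR ?nnegrE// (le_trans ler01).
pose f (r : R) := (expR (g * `|r|))%:E.
have mf : measurable_fun [set: R] f.
  apply/measurable_EFinP; apply: measurableT_comp => //.
  exact: measurable_funM.
(* [lebesgue_measure] is a measure on [measurableTypeR R], which is not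
   convertible to [R] as a measurable type. *)
have mx : measurable_fun [set: Omega] (x : Omega -> measurableTypeR R).
  by move=> mT Y mY; exact: (@measurable_funP _ _ _ _ setT x mT Y mY).
pose x' : {mfun Omega >-> measurableTypeR R} :=
  HB.pack (x : Omega -> measurableTypeR R) (isMeasurableFun.Build _ _ _ _ _ mx).
have -> : (\int[P]_w (expR (g * `|x w|))%:E =
    \int[distribution P x']_r f r)%E.
  by rewrite ge0_integral_distribution// => r; rewrite lee_fin expR_ge0.
rewrite (@ge0_integral_density _ _ _ (distribution P x') lebesgue_measure G)//;
  last by move=> r; rewrite lee_fin expR_ge0.
apply: (@le_trans _ _ (\int[lebesgue_measure]_r
    ((expR (1 / 2) * expR B)%:E * (expR (- (e * `|r|)))%:E))%E).
  apply: ge0_le_integral => //.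
  - by move=> r _; rewrite mule_ge0// lee_fin expR_ge0.
  - exact: emeasurable_funM.
  - apply: measurable_funeM; apply/measurable_EFinP; exact: measurable_expR_abs.
  - move=> r _; rewrite /f /G -!EFinM lee_fin mulrCA -[leRHS]mulrA.
    rewrite ler_pM ?mulr_ge0 ?expR_ge0// ?(ltW c0)// -!expRD ler_expR.
    exact: HB (normr_ge0 r).
rewrite ge0_integralZl//; last by apply/measurable_EFinP; exact: measurable_expR_abs.
by rewrite integral_expR_abs// -EFinM.
Qed.

Lemma nneseries_inv_sqr (R : realType) :
  (\sum_(0 <= n <oo) ((n.+1%:R ^- 2 : R))%:E <= 2%:E)%E.
Proof.
apply: lime_le.
  by apply: is_cvg_nneseries => n _ _; rewrite lee_fin invr_ge0 exprn_ge0.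
apply: nearW => n; rewrite sumEFin lee_fin.
(* The invariant 2 - 2 / (n + 1) is an equality for the empty sum, and its increments dominate the
   terms of the series. *)
apply: (@le_trans _ _ (2 - 2 / n.+1%:R)); last by rewrite gerBl divr_ge0.
elim: n => [|n IH]; first by rewrite big_geq// divr1 subrr.
rewrite big_nat_recr//=; apply: (le_trans (lerD IH (lexx _))).
rewrite -[n.+2%:R]natr1; have : 1 <= n.+1%:R :> R by rewrite ler1n.
move: (n.+1%:R) => x x1; rewrite -subr_ge0.
have x0 : x != 0 by rewrite gt_eqF// (lt_le_trans ltr01).
have x10 : x + 1 != 0 by rewrite gt_eqF// addr_gt0// (lt_le_trans ltr01).
have -> : 2 - 2 / (x + 1) - (2 - 2 / x + x ^- 2) = (x - 1) / (x ^+ 2 * (x + 1)).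
  by field; rewrite x0 x10.
rewrite divr_ge0 ?subr_ge0// mulr_ge0 ?sqr_ge0//; lra.
Qed.

(* For [y = l^-b k x <= 1] the first summand suffices; for [y > 1] one inserts
   [y^m >= 1] with [m b >= 2] and absorbs [x^m] into [exp (e x)]. *)
Lemma expR_weighted_le (R : realType) (g k b e : R) : 0 < g -> 0 < k -> 0 < b ->
  0 < e -> exists2 D : R, 0 < D & forall (l : nat) (x : R), 0 <= x ->
    expR (g * (l.+1%:R `^ (- b) * (k * x))) <=
    expR g + D * (l.+1%:R ^- 2 * expR ((g * k + e) * x)).
Proof.
move=> g0 k0 b0 e0.
(* This m makes l^(-b m) <= l^-2. *)
pose m := (Num.truncn (2 / b)).+1.
have mb : 2 <= b * m%:R.
  by rewrite mulrC -ler_pdivrMr//; apply/ltW; exact: truncnS_gt.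
have D0 : 0 < k ^+ m * (m`!%:R / e ^+ m).
  by rewrite mulr_gt0 ?divr_gt0 ?exprn_gt0// ltr0n fact_gt0.
exists (k ^+ m * (m`!%:R / e ^+ m)) => // l x x0.
set y := _ `^ _ * _.
have L0 : 0 < l.+1%:R :> R by rewrite ltr0n.
have L1 : 1 <= l.+1%:R :> R by rewrite ler1n.
have Lb1 : l.+1%:R `^ (- b) <= 1 :> R.
  by rewrite -[leRHS](powRr0 l.+1%:R) ler_powR// oppr_le0 ltW.
have y0 : 0 <= y by rewrite mulr_ge0 ?powR_ge0// mulr_ge0// ltW.
have tail0 : 0 <= k ^+ m * (m`!%:R / e ^+ m) *
    (l.+1%:R ^- 2 * expR ((g * k + e) * x)).
  by rewrite mulr_ge0 ?ltW// mulr_gt0 ?expR_gt0// invr_gt0 exprn_gt0.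
have [y1|y1] := leP y 1.
  apply: (@le_trans _ _ (expR g)); last by rewrite lerDl.
  by rewrite ler_expR ler_piMr// ltW.
apply: (@le_trans _ _ (y ^+ m * expR (g * (k * x)))).
  rewrite -[leLHS]mul1r ler_pM ?expR_ge0 ?exprn_ege1 ?(ltW y1)//.
  by rewrite ler_expR ler_pM2l// ler_piMl// mulr_ge0// ltW.
apply: (@le_trans _ _ (k ^+ m * (m`!%:R / e ^+ m) *
    (l.+1%:R ^- 2 * expR ((g * k + e) * x)))); last by rewrite lerDr expR_ge0.
(* One term of the exponential series: (e x)^m / m! <= exp(e x). This is the source of the constant
   D. *)
have xm : x ^+ m <= m`!%:R / e ^+ m * expR (e * x).
  have := @expR_ge1Dxn R (e * x) m.-1 (mulr_ge0 (ltW e0) x0).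
  rewrite prednK// => h.
  rewrite mulrAC ler_pdivlMr ?exprn_gt0// -exprMn [x * e]mulrC.
  rewrite -ler_pdivrMl ?ltr0n ?fact_gt0//; lra.
have Lm : l.+1%:R `^ (- b) ^+ m <= l.+1%:R ^- 2 :> R.
  rewrite -powR_mulrn ?powR_ge0// -powRrM mulNr powRN.
  rewrite lef_pV2 ?posrE ?powR_gt0 ?exprn_gt0//.
  by rewrite -powR_mulrn ?(ltW L0)// ler_powR.
rewrite /y !exprMn mulrDl expRD.
have -> : k ^+ m * (m`!%:R / e ^+ m) *
    (l.+1%:R ^- 2 * (expR (g * k * x) * expR (e * x))) =
    l.+1%:R ^- 2 * (k ^+ m * (m`!%:R / e ^+ m * expR (e * x))) * expR (g * k * x).
  move: (k ^+ m) (m`!%:R / _) (_ ^- 2) (expR (g * k * x)) (expR (e * x)).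
  by move=> u1 u2 u3 u4 u5; ring.
rewrite [g * (k * x)]mulrA ler_wpM2r ?expR_ge0// ler_pM ?exprn_ge0 ?powR_ge0//.
  by rewrite mulr_ge0 ?exprn_ge0// ltW.
by rewrite ler_wpM2l ?exprn_ge0// ltW.
Qed.

Lemma measurable_norm_borel (R : realType) (X : normedModType R) :
  measurable_fun [set: borel X] (fun x : borel X => `|x : X|).
Proof.
apply: (measurability _ (RGenOInfty.measurableE R)) => _ [_ [a ->]] <-.
apply: measurableI => //; apply: sub_sigma_algebra.
apply: (@open_comp X R (fun x : X => `|x|)) => [x _|]; first exact: norm_continuous.
exact: interval_open.
Qed.

Lemma besov_measure_exp_moment (R : realType) (X : normedModType R)
    (d : nat) (psi : nat -> 'rV[R]_d -> R) (iota : functional R d -> X)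
    (s t q kappa ce alpha : R) (mu0 : probability (borel X) R) :
  (0 < d)%N -> Ct_embedding psi t iota ce -> 1 <= q -> t + d%:R / q < s ->
  0 < kappa -> besov_measure psi s q kappa iota mu0 -> 0 < alpha ->
  (q = 1 -> 2 * ce * alpha < kappa) ->
  (\int[mu0]_u (expR (alpha * `|u|))%:E < +oo)%E.
Proof.
move=> d0 [_ _ iota_le] q1 ts kappa0.
move=> [dO [S [P [xi [u [_ xilaw uexp miu mu0E]]]]]] alpha0 ce_kappa.
have d0R : 0 < d%:R :> R by rewrite ltr0n.
have q0 : 0 < q by apply: lt_le_trans q1.
pose b := (s - t) / d%:R - 1 / q.
have b0 : 0 < b.
  rewrite subr_gt0 ltr_pdivlMr//; rewrite mul1r mulrC; lra.
pose k := (1 / kappa) `^ (1 / q).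
have k0 : 0 < k by rewrite powR_gt0// divr_gt0.
(* The second entry keeps g positive even if ce <= 0. For q = 1, where k = 1 / kappa, it contributes
   only 1/4 to g k, below the threshold 1/2. *)
pose g := Num.max (alpha * ce) (kappa / 4).
have g0 : 0 < g by rewrite lt_max divr_gt0// orbT.
have gk : q = 1 -> g * k < 1 / 2.
  move=> q1E; rewrite /k q1E divr1 powRr1 ?divr_ge0 ?ltW//.
  rewrite mulrA mulr1 ltr_pdivrMr// gt_max; have := ce_kappa q1E.
  by move=> ?; apply/andP; split; lra.
(* For q = 1, half of the gap below 1/2 is kept as room for absorbing x^m. *)
have [e e0 gke] : exists2 e : R, 0 < e & q = 1 -> g * k + e < 1 / 2.
  have [q1E|qN1] := eqVneq q 1; last first.
    by exists 1 => // q1E; rewrite q1E eqxx in qN1.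
  by exists ((1 / 2 - g * k) / 2) => [|_]; have := gk q1E; lra.
have [D D0 HD] := expR_weighted_le g0 k0 b0 e0.
have [K HK] := exp_power_law_exp_moment q1 gke.
pose W w := (\sum_(0 <= l <oo)
  ((l.+1%:R ^- 2)%:E * (expR ((g * k + e) * `|xi l.+1 w|))%:E))%E.
have mterm l : measurable_fun [set: S]
    (fun w => (expR ((g * k + e) * `|xi l.+1 w|))%:E).
  apply/measurable_EFinP; apply: measurableT_comp => //.
  by apply: measurable_funM => //; exact: measurableT_comp.
have W0 w : (0 <= W w)%E.
  by apply: nneseries_ge0 => l _ _; rewrite mule_ge0 ?lee_fin ?expR_ge0// invr_ge0 exprn_ge0.
have mW : measurable_fun [set: S] W.
  apply: ge0_emeasurable_sum => [l w _ _|l _].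
    by rewrite mule_ge0 ?lee_fin ?expR_ge0// invr_ge0 exprn_ge0.
  exact: measurable_funeM.
have intW : (\int[P]_w W w < +oo)%E.
  rewrite integral_nneseries//; last by move=> l; exact: measurable_funeM.
  have K0 : 0 <= K.
    rewrite -lee_fin; apply: le_trans (HK _ _ _ _ (xilaw 1%N isT)).
    by apply: integral_ge0 => w _; rewrite lee_fin expR_ge0.
  apply: (@le_lt_trans _ _ (K%:E * (\sum_(0 <= l <oo) (l.+1%:R ^- 2)%:E))%E); last first.
    apply: (@le_lt_trans _ _ (K%:E * 2%:E)%E); last by rewrite -EFinM ltry.
    by rewrite lee_wpmul2l ?lee_fin// nneseries_inv_sqr.
  rewrite -nneseriesZl//.
  apply: lee_nneseries => [l *|l *].
    by apply: integral_ge0 => w _; rewrite mule_ge0 ?lee_fin ?expR_ge0// invr_ge0 exprn_ge0.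
  rewrite ge0_integralZl//.
  rewrite muleC lee_wpmul2r ?lee_fin ?invr_ge0 ?exprn_ge0//.
  exact: HK (xilaw l.+1 isT).
have mnorm : measurable_fun [set: borel X] (fun x : borel X => (expR (alpha * `|x : X|))%:E).
  apply/measurable_EFinP; apply: measurableT_comp => //.
  by apply: measurable_funM => //; exact: measurable_norm_borel.
have -> : (\int[mu0]_x (expR (alpha * `|x|))%:E =
    \int[P]_w (expR (alpha * `|iota (u w)|))%:E)%E.
  rewrite -[RHS](@ge0_integral_pushforward _ _ _ _ _ _ miu P setT
    (fun x : borel X => (expR (alpha * `|x : X|))%:E))//.
    by apply: eq_measure_integral => A mA _; exact: mu0E.
apply: (@le_lt_trans _ _ (\int[P]_w ((expR g)%:E + D%:E * W w))%E); last first.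
  rewrite ge0_integralD//; last 2 first.
  - by move=> w _; rewrite mule_ge0// lee_fin ltW.
  - exact: measurable_funeM.
  have -> : (\int[P]__ (expR g)%:E = (expR g)%:E)%E.
    by rewrite integral_cst// [X in (_ * X)%E](probability_setT P) mule1.
  rewrite ge0_integralZl//; last by rewrite lee_fin ltW.
  by rewrite lte_add_pinfty ?ltry// lte_mul_pinfty// lee_fin ltW.
apply: ae_ge0_le_integral => //.
- exact: (measurableT_comp mnorm miu).
- by move=> w _; rewrite adde_ge0 ?mule_ge0 ?lee_fin ?expR_ge0// ltW.
- by apply: emeasurable_funD => //; exact: measurable_funeM.
apply: filterS uexp => w uw _.
(* Where W is infinite the bound is trivial; elsewhere B below is a real number. *)
have [Woo|Wfin] := eqVneq (W w) +oo%E.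
  by rewrite Woo gt0_muley ?lte_fin// addey// leey.
have {}Wfin : W w \is a fin_num by rewrite ge0_fin_numE// ltey.
rewrite -(fineK Wfin) -EFinM -EFinD lee_fin.
set B := _ + _.
have Bg : expR g <= B by rewrite lerDl mulr_ge0 ?fine_ge0// ltW.
have B0 : 0 < B by apply: lt_le_trans Bg; exact: expR_gt0.
set a := (fun l => _) in uw.
(* The exponents t/d + 1/2 and -(s/d + 1/2 - 1/q) add up to -b, so each weighted coefficient is an
   X_l with exp(g X_l) <= B. This also shows that u lies in C^t almost surely. *)
have Bcoef x : weighted_coefs d t a x -> 0 <= x <= ln B / g.
  move=> [[//|l] _ <-]; apply/andP; split; first by rewrite mulr_ge0 ?powR_ge0.
  rewrite ler_pdivlMr// mulrC -ler_expR lnK ?posrE//.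
  have -> : l.+1%:R `^ (t / d%:R + 1 / 2) * `|a l.+1| =
      l.+1%:R `^ (- b) * (k * `|xi l.+1 w|).
    rewrite /a !normrM !(ger0_norm (powR_ge0 _ _)) !mulrA -powRD; last first.
      by rewrite pnatr_eq0 implybT.
    congr (_ `^ _ * _ * _); rewrite /b; field.
    by rewrite !gt_eqF.
  apply: le_trans (HD l _ (normr_ge0 _)) _; rewrite lerD2l ler_wpM2l ?(ltW D0)//.
  rewrite -lee_fin fineK// EFinM.
  have u0 i : (0 <= (i.+1%:R ^- 2 : R)%:E *
      (expR ((g * k + e) * `|xi i.+1 w|))%:E)%E.
    by rewrite mule_ge0 ?lee_fin ?expR_ge0// invr_ge0 exprn_ge0.
  apply: le_trans (nneseries_lim_ge l.+1 (fun i _ _ => u0 i)).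
  by rewrite big_nat_recr//= leeDr// sume_ge0.
have [x0 x0in] : weighted_coefs d t a !=set0 by eexists; exists 1%N.
have ubB : ubound (weighted_coefs d t a) (ln B / g).
  by move=> x /Bcoef /andP[].
(* The sign of the supremum allows alpha ce to be replaced by the larger g. *)
have sup0 : 0 <= sup (weighted_coefs d t a).
  have /andP[x00 _] := Bcoef _ x0in; apply: le_trans x00 _.
  by apply: ub_le_sup => //; exists (ln B / g).
have supB : sup (weighted_coefs d t a) <= ln B / g.
  by apply: ge_sup => //; exists x0.
rewrite -[leRHS]lnK ?posrE// ler_expR.
have := iota_le _ _ uw (ex_intro _ _ ubB).
rewrite -(ler_pM2l alpha0) => /le_trans; apply.
rewrite mulrA; apply: (@le_trans _ _ (g * sup (weighted_coefs d t a))).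
  by rewrite ler_wpM2r// le_max lexx.
by rewrite -ler_pdivlMl// mulrC.
Qed.

(** * The Hellinger distance *)

(** This is the expansion of |x - c y|^2 for unit vectors, with the cross term moved to the left so
    that all integrands are nonnegative and the extended integrals add without integrability
    conditions. *)
Lemma integral_sqr_subZ (d : measure_display) (T : measurableType d)
    (R : realType) (nu : {measure set T -> \bar R}) (x y : T -> R) (c : R) :
  measurable_fun setT x -> measurable_fun setT y ->
  (forall u, 0 <= x u) -> (forall u, 0 <= y u) -> 0 <= c ->
  (\int[nu]_u ((x u) ^+ 2)%:E = 1)%E -> (\int[nu]_u ((y u) ^+ 2)%:E = 1)%E ->
  (\int[nu]_u ((x u - c * y u) ^+ 2)%:E + (2 * c)%:E * \int[nu]_u (x u * y u)%:E =
   (1 + c ^+ 2)%:E)%E.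
Proof.
move=> mx my x0 y0 c0 x1 y1.
have mxy : measurable_fun setT (fun u => (x u * y u)%:E).
  by apply/measurable_EFinP; exact: measurable_funM.
have xy0 u : (0 <= (x u * y u)%:E)%E by rewrite lee_fin mulr_ge0.
have mx2 : measurable_fun setT (fun u => ((x u) ^+ 2)%:E).
  by apply/measurable_EFinP; exact: measurable_funX.
have my2 : measurable_fun setT (fun u => ((y u) ^+ 2)%:E).
  by apply/measurable_EFinP; exact: measurable_funX.
have sq0 (z : T -> R) u : (0 <= ((z u) ^+ 2)%:E)%E by rewrite lee_fin sqr_ge0.
have mcy2 : measurable_fun setT (fun u => (c ^+ 2)%:E * ((y u) ^+ 2)%:E)%E.
  exact: measurable_funeM.
transitivity (\int[nu]_u (((x u - c * y u) ^+ 2)%:E + (2 * c)%:E * (x u * y u)%:E))%E.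
  rewrite ge0_integralD//.
  - by rewrite ge0_integralZl// lee_fin mulr_ge0.
  - by move=> u _; exact: (sq0 (fun u => x u - c * y u)).
  - apply/measurable_EFinP; apply: measurable_funX; apply: measurable_funB => //.
    exact: measurable_funM.
  - by move=> u _; rewrite mule_ge0// lee_fin mulr_ge0.
  - exact: measurable_funeM.
transitivity (\int[nu]_u (((x u) ^+ 2)%:E + (c ^+ 2)%:E * ((y u) ^+ 2)%:E))%E.
  by apply: eq_integral => u _; rewrite -!EFinM -!EFinD; congr EFin; ring.
rewrite ge0_integralD//.
- by rewrite ge0_integralZl ?lee_fin ?sqr_ge0// x1 y1 mule1 -EFinD.
- by move=> u _; rewrite mule_ge0 ?lee_fin ?sqr_ge0.
Qed.

(* For unit vectors with [r = <x, y>] in [0, 1], one has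
   |x - y|^2 = 2 (1 - r) <= 2 (1 - r^2) <= 2 |x - c y|^2. *)
Lemma integral_sqr_sub_le (d : measure_display) (T : measurableType d)
    (R : realType) (nu : {measure set T -> \bar R}) (x y : T -> R) (c : R) :
  measurable_fun setT x -> measurable_fun setT y ->
  (forall u, 0 <= x u) -> (forall u, 0 <= y u) -> 0 <= c ->
  (\int[nu]_u ((x u) ^+ 2)%:E = 1)%E -> (\int[nu]_u ((y u) ^+ 2)%:E = 1)%E ->
  (\int[nu]_u ((x u - y u) ^+ 2)%:E <=
   2%:E * \int[nu]_u ((x u - c * y u) ^+ 2)%:E)%E.
Proof.
move=> mx my x0 y0 c0 x1 y1.
have Ec := integral_sqr_subZ mx my x0 y0 c0 x1 y1.
have E1 := integral_sqr_subZ mx my x0 y0 ler01 x1 y1.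
have {E1} : (\int[nu]_u ((x u - y u) ^+ 2)%:E + 2%:E * \int[nu]_u (x u * y u)%:E
    = 2%:E)%E.
  move: E1; rewrite expr1n mulr1 => E1.
  rewrite -[RHS]E1; congr (_ + _)%E.
  by apply: eq_integral => u _; rewrite mul1r.
have : (0 <= \int[nu]_u (x u * y u)%:E)%E.
  by apply: integral_ge0 => u _; rewrite lee_fin mulr_ge0.
have : (0 <= \int[nu]_u ((x u - y u) ^+ 2)%:E)%E.
  by apply: integral_ge0 => u _; rewrite lee_fin sqr_ge0.
move: Ec.
(* Infinite values contradict the signs or the finite right-hand sides, which leaves an inequality
   between real numbers. *)
case: (\int[nu]_u ((x u - y u) ^+ 2)%:E)%E => [A| |];
  case: (\int[nu]_u (x u * y u)%:E)%E => [r| |] //=;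
  rewrite ?(@gt0_muley _ 2%:E) ?lte_fin//.
case: (\int[nu]_u ((x u - c * y u) ^+ 2)%:E)%E => [B| |] //=.
rewrite -?EFinM -?EFinD ?lee_fin => -[EB] A0 r0 [EA].
have r1 : r <= 1 by lra.
have -> : A = 2 - 2 * r by lra.
have -> : B = 1 + c ^+ 2 - 2 * c * r by lra.
have := sqr_ge0 (c - r); nra.
Qed.

(** By the chain rule both densities with respect to nu carry the factor dmu0/dnu, which moves the
    integral of the squared difference from nu to mu0. The 1/2 in the Hellinger distance cancels the
    2 of [integral_sqr_sub_le]. *)
Lemma hellinger_le (d : measure_display) (T : measurableType d) (R : realType)
    (nu : {sigma_finite_measure set T -> \bar R}) (mu0 mu mu' : probability T R)
    (c B : R) : mu0 `<< nu -> mu `<< mu0 -> mu' `<< mu0 -> 0 <= c ->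
  (\int[mu0]_u ((Num.sqrt (fine (Radon_Nikodym (charge_of_finite_measure mu) mu0 u))
     - c * Num.sqrt (fine (Radon_Nikodym (charge_of_finite_measure mu') mu0 u)))
     ^+ 2)%:E <= B%:E)%E ->
  hellinger nu mu mu' <= Num.sqrt B.
Proof.
move=> mu0nu mumu0 mu'mu0 c0.
set p := Radon_Nikodym (charge_of_finite_measure mu) mu0.
set p' := Radon_Nikodym (charge_of_finite_measure mu') mu0 => leB.
have munu := null_dominates_trans mumu0 mu0nu.
have mu'nu := null_dominates_trans mu'mu0 mu0nu.
(* This version of dm/dnu is finite and nonnegative everywhere, so its square root squares back at
   every point. It is compared with [Radon_Nikodym] only a.e. *)
pose F (m : probability T R) := Radon_Nikodym_SigmaFinite.f m nu.
pose x (m : probability T R) u : R := Num.sqrt (fine (F m u)).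
have mF (m : probability T R) : m `<< nu -> measurable_fun setT (F m).
  by move=> mnu; exact: measurable_int (Radon_Nikodym_SigmaFinite.f_integrable mnu).
have mx (m : probability T R) : m `<< nu -> measurable_fun setT (x m).
  move=> mnu; apply: (measurableT_comp (continuous_measurable_fun (@sqrt_continuous R))).
  by apply: measurableT_comp => //; exact: mF.
have x1 (m : probability T R) : m `<< nu -> (\int[nu]_u ((x m u) ^+ 2)%:E = 1)%E.
  move=> mnu; rewrite -(probability_setT m) (Radon_Nikodym_SigmaFinite.f_integral mnu)//.
  apply: eq_integral => u _; rewrite sqr_sqrtr ?fineK//.
    exact: Radon_Nikodym_SigmaFinite.f_fin_num.
  by apply: fine_ge0; exact: Radon_Nikodym_SigmaFinite.f_ge0.
have mp (m : probability T R) : m `<< mu0 ->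
    measurable_fun setT (fine \o Radon_Nikodym (charge_of_finite_measure m) mu0).
  by move=> mmu0; apply: measurableT_comp => //; exact: measurable_int
    (Radon_Nikodym_integrable _).
have chain (m : probability T R) : m `<< mu0 -> ae_eq nu setT (x m)
    (fun u => Num.sqrt (fine (F mu0 u)) *
      Num.sqrt (fine (Radon_Nikodym (charge_of_finite_measure m) mu0 u))).
  move=> mmu0; have mnu := null_dominates_trans mmu0 mu0nu.
  have H1 := ae_eq_Radon_Nikodym_SigmaFinite mnu measurableT.
  have H2 := ae_eq_Radon_Nikodym_SigmaFinite mu0nu measurableT.
  have H3 := @Radon_Nikodym_chain_rule _ _ _ (charge_of_finite_measure m) nu mu0 mmu0 mu0nu.
  apply: filterS3 H1 H2 H3 => u h1 h2 h3 _.
  rewrite /x /F h1// h3//= -h2// fineM; last 2 first.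
  - exact: Radon_Nikodym_fin_num.
  - exact: Radon_Nikodym_SigmaFinite.f_fin_num.
  rewrite mulrC sqrtrM//.
  by apply: fine_ge0; exact: Radon_Nikodym_SigmaFinite.f_ge0.
pose G u := (Num.sqrt (fine (p u)) - c * Num.sqrt (fine (p' u))) ^+ 2.
have mG : measurable_fun setT G.
  apply: measurable_funX; apply: measurable_funB.
    apply: (measurableT_comp (continuous_measurable_fun (@sqrt_continuous R))).
    exact: mp.
  apply: measurable_funM => //.
  apply: (measurableT_comp (continuous_measurable_fun (@sqrt_continuous R))).
  exact: mp.
(* The common factor sqrt(dmu0/dnu) is pulled out of the square, where it becomes the density
   dmu0/dnu. *)
have xG : (\int[nu]_u ((x mu u - c * x mu' u) ^+ 2)%:E = \int[mu0]_u (G u)%:E)%E.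
  rewrite -(Radon_Nikodym_SigmaFinite.change_of_variables mu0nu)//; last 2 first.
  - by move=> u; rewrite lee_fin sqr_ge0.
  - exact/measurable_EFinP.
  apply: ge0_ae_eq_integral => //.
  - apply/measurable_EFinP/measurable_funX/measurable_funB; first exact: mx.
    by apply: measurable_funM => //; exact: mx.
  - by apply: emeasurable_funM; [exact/measurable_EFinP|exact: mF].
  - by move=> u _; rewrite lee_fin sqr_ge0.
  - by move=> u _; rewrite mule_ge0 ?lee_fin ?sqr_ge0// Radon_Nikodym_SigmaFinite.f_ge0.
  apply: filterS2 (chain _ mumu0) (chain _ mu'mu0) => u h h' _.
  rewrite h// h'// -[X in (_ * X)%E]fineK; last exact: Radon_Nikodym_SigmaFinite.f_fin_num.
  rewrite -EFinM; congr EFin.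
  have F0 : 0 <= fine (F mu0 u).
    by apply: fine_ge0; exact: Radon_Nikodym_SigmaFinite.f_ge0.
  transitivity (G u * Num.sqrt (fine (F mu0 u)) ^+ 2); last by rewrite sqr_sqrtr.
  by rewrite /G /p /p'; ring.
have ge0I (z : T -> R) : (0 <= \int[nu]_u ((z u) ^+ 2)%:E)%E.
  by apply: integral_ge0 => u _; rewrite lee_fin sqr_ge0.
have le2B : (\int[nu]_u ((x mu u - x mu' u) ^+ 2)%:E <= (2 * B)%:E)%E.
  apply: (le_trans (integral_sqr_sub_le (mx _ munu) (mx _ mu'nu) _ _ c0 (x1 _ munu) (x1 _ mu'nu))).
  - by move=> u; exact: sqrtr_ge0.
  - by move=> u; exact: sqrtr_ge0.
  by rewrite xG EFinM lee_wpmul2l// lee_fin.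
rewrite /hellinger; apply: ler_wsqrtr.
rewrite /Rintegral (_ : integral _ _ _ =
    \int[nu]_u ((x mu u - x mu' u) ^+ 2)%:E)%E; last first.
  have mRN (m : probability T R) : m `<< nu -> measurable_fun setT
      (fun u => Num.sqrt (fine (Radon_Nikodym (charge_of_finite_measure m) nu u))).
    move=> mnu; apply: (measurableT_comp (continuous_measurable_fun (@sqrt_continuous R))).
    by apply: measurableT_comp => //; exact: measurable_int (Radon_Nikodym_integrable _).
  apply: ge0_ae_eq_integral => //.
  - apply/measurable_EFinP/measurable_funX; apply: measurable_funB; exact: mRN.
  - apply/measurable_EFinP/measurable_funX; apply: measurable_funB; exact: mx.
  - by move=> u _; rewrite lee_fin sqr_ge0.
  - by move=> u _; rewrite lee_fin sqr_ge0.
  have H := ae_eq_Radon_Nikodym_SigmaFinite munu measurableT.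
  have H' := ae_eq_Radon_Nikodym_SigmaFinite mu'nu measurableT.
  by apply: filterS2 H H' => u h h' _; rewrite /x /F h// h'.
rewrite mul1r ler_pdivrMl// -lee_fin fineK//.
by rewrite ge0_fin_numE//; exact: le_lt_trans le2B (ltry _).
Qed.

(** If the integral of f over A vanishes, then f = 0 a.e. on A; as f > 0, the set A is null. *)
Lemma has_density_gt0_dominates (d : measure_display) (T : measurableType d)
    (R : realType) (mu mu0 : probability T R) (f : T -> R) :
  has_density mu mu0 f -> (forall u, 0 < f u) -> mu0 `<< mu.
Proof.
move=> [mumu0 pf] f0; apply/null_content_dominatesP => A mA muA0.
have F0 := Radon_Nikodym_SigmaFinite.f_ge0 mumu0.
have mF : measurable_fun setT (Radon_Nikodym_SigmaFinite.f mu mu0).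
  exact: measurable_int (Radon_Nikodym_SigmaFinite.f_integrable mumu0).
have : ae_eq mu0 A (Radon_Nikodym_SigmaFinite.f mu mu0) (cst 0%E).
  apply/ae_eq_integral_abs => //; first exact: measurable_funTS.
  under eq_integral do rewrite gee0_abs//.
  by rewrite -(Radon_Nikodym_SigmaFinite.f_integral mumu0).
have H := ae_eq_Radon_Nikodym_SigmaFinite mumu0 measurableT.
move=> FA; have : \forall u \ae mu0, ~ A u.
  apply: filterS3 H pf FA => u h1 h2 h3 Au; move: (h3 Au).
  by rewrite h1// h2// => -[] /eqP; rewrite gt_eqF.
move=> [N [mN N0 AN]]; apply/eqP; rewrite eq_le measure_ge0 andbT -N0.
by apply: le_measure; rewrite ?inE// => u Au; apply: AN => /=; exact.
Qed.

(** The factor a will be the inverse of a normalising integral, which reads as 0 if that integral is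
    0 or infinite. A zero factor is excluded because mu has mass 1. *)
Lemma has_density_scale_gt0 (d : measure_display) (T : measurableType d)
    (R : realType) (mu mu0 : probability T R) (a : R) (f : T -> R) :
  has_density mu mu0 (fun u => a * f u) -> 0 <= a -> 0 < a.
Proof.
move=> [mumu0 pf] a0; rewrite lt_neqAle a0 andbT; apply/eqP => aE.
have := probability_setT mu.
rewrite (Radon_Nikodym_SigmaFinite.f_integral mumu0)//.
have H := ae_eq_Radon_Nikodym_SigmaFinite mumu0 measurableT.
rewrite (@ae_eq_integral _ _ _ mu0 setT (cst 0%E))//.
- by rewrite integral0 => -[] /esym/eqP; rewrite oner_eq0.
- exact: measurable_int (Radon_Nikodym_SigmaFinite.f_integrable mumu0).
by apply: filterS2 H pf => u h1 h2 _; rewrite h1// h2// -aE mul0r.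
Qed.

(** * Pointwise estimate of the square roots of the densities, and the final bound *)

Lemma sqrt_expR (R : realType) (x : R) : Num.sqrt (expR x) = expR (x / 2).
Proof.
have -> : x = 2%:R * (x / 2) by lra.
rewrite expRM_natl sqrtr_sqr ger0_norm ?expR_ge0//; congr expR; lra.
Qed.

(** On [m, +oo) the function exp(-x / 2) is Lipschitz with constant at most exp(-m / 2). For a <= b
    one factors out exp(-a / 2) and uses 1 - exp(-v) <= v with v = (b - a) / 2. *)
Lemma expR_half_sub_sqr_le (R : realType) (m a b : R) : m <= a -> m <= b ->
  (expR (- a / 2) - expR (- b / 2)) ^+ 2 <= expR (- m) * (a - b) ^+ 2.
Proof.
wlog ab : a b / a <= b => [H ma mb|].
  have [ab|/ltW ba] := leP a b; first exact: H.
  by rewrite -(sqrrN (a - b)) -(sqrrN (_ - expR _)) !opprB; exact: H.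
move=> ma _.
have em : expR (- m) = expR (- m / 2) ^+ 2.
  by rewrite -expRM_natl; congr expR; lra.
rewrite em -(sqrrN (a - b)) opprB -exprMn.
have bE : expR (- b / 2) = expR (- a / 2) * expR ((a - b) / 2).
  by rewrite -expRD; congr expR; lra.
have h1 := expR_ge1Dx ((a - b) / 2).
have h2 : expR ((a - b) / 2) <= 1 by rewrite expR_le1; lra.
have a0 := expR_gt0 (- a / 2).
have am : expR (- a / 2) <= expR (- m / 2) by rewrite ler_expR; lra.
rewrite lerXn2r ?nnegrE//.
- by rewrite bE subr_ge0 ler_piMr// ltW.
- by rewrite mulr_ge0 ?expR_ge0// subr_ge0.
rewrite bE -[X in X - _]mulr1 -mulrBr ler_pM ?expR_ge0 ?subr_ge0//; lra.
Qed.

Unset Implicit Arguments.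

Theorem theorem3p4 (R : realType) (X Y : completeNormedModType R)
  (Phi : X -> Y -> R) (PhiN : nat -> X -> Y -> R) (y : Y)
  (mu0 mu : probability (borel X) R) (muN : nat -> probability (borel X) R)
  (alpha1 alpha3 C : R) (rate : nat -> R)
  (d : nat) (s t q kappa ce r1 : R)
  (rho : nat) (psi : nat -> 'rV[R]_d -> R) (iota : functional R d -> X)
  (hd : (0 < d <= 3)%N)
  (hmu : has_density mu mu0
     (fun u : X => (\int[mu0]_v expR (- Phi v y))^-1 * expR (- Phi u y)))
  (hmuN : forall N, has_density (muN N) mu0
     (fun u : X => (\int[mu0]_v expR (- PhiN N v y))^-1 * expR (- PhiN N u y)))
  (halpha1 : 0 < alpha1)
  (hlower : forall r : R, 0 < r -> exists M : R,
     forall Psi : X -> Y -> R, (Psi = Phi \/ exists N, Psi = PhiN N) ->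
     forall (u : X) (z : Y), `|z| < r -> M - alpha1 * `|u| <= Psi u z)
  (hupper : forall r : R, 0 < r -> exists2 K : R, 0 < K &
     forall Psi : X -> Y -> R, (Psi = Phi \/ exists N, Psi = PhiN N) ->
     forall (u : X) (z : Y), Num.max `|u| `|z| < r -> Psi u z <= K)
  (halpha3 : 0 <= alpha3)
  (happrox : forall N (u : X),
     `|Phi u y - PhiN N u y| <= expR (alpha3 * `|u| + C) * rate N)
  (hrate : rate @ \oo --> (0 : R))
  (hrho : s < rho%:R)
  (hpsi : regular_wavelet_basis rho psi)
  (hiota : Ct_embedding psi t iota ce)
  (hq : 1 <= q)
  (hs : t + d%:R / q < s)
  (hr1 : 0 < r1)
  (hr1c : r1_condition s t d q r1)
  (hkappa0 : 0 < kappa)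
  (hmu0 : besov_measure psi s q kappa iota mu0)
  (hkappa : 2 * ce * r_star r1 q d * (alpha1 + 2 * alpha3) < kappa) :
  exists C0 : R, forall (N : nat)
    (nu : {sigma_finite_measure set (borel X) -> \bar R}),
    mu `<< nu -> muN N `<< nu -> hellinger nu mu (muN N) <= C0 * rate N.
Proof.
have /andP[d0 d3] := hd.
pose alpha := alpha1 + 2 * alpha3.
have alpha0 : 0 < alpha by rewrite ltr_pwDl// mulr_ge0.
have mexp_lty : (\int[mu0]_u (expR (alpha * `|u : X|))%:E < +oo)%E.
  apply: (besov_measure_exp_moment d0 hiota hq hs hkappa0 hmu0 alpha0) => qE.
  (* If ce <= 0 the product 2 ce alpha is nonpositive; otherwise the factor [r_star] >= 1 may be
     inserted. *)
  have [ce0|ce0] := leP ce 0.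
    by apply: le_lt_trans hkappa0; rewrite mulr_le0_ge0 ?(ltW alpha0)// mulr_ge0_le0.
  apply: le_lt_trans hkappa; rewrite ler_wpM2r ?(ltW alpha0)//.
  by rewrite ler_peMr ?mulr_ge0 ?(ltW ce0)// qE r_star1_ge1.
have mexp : measurable_fun [set: borel X] (fun u : borel X => (expR (alpha * `|u : X|))%:E).
  apply/measurable_EFinP; apply: measurableT_comp => //.
  by apply: measurable_funM => //; exact: measurable_norm_borel.
set E := (\int[mu0]_u _)%E in mexp_lty.
have E0 : (0 <= E)%E by apply: integral_ge0 => u _; rewrite lee_fin expR_ge0.
have Efin : E \is a fin_num by rewrite ge0_fin_numE.
have rate0 N : 0 <= rate N.
  by have := le_trans (normr_ge0 _) (happrox N 0); rewrite pmulr_rge0 ?expR_gt0.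
have [M HM] := hlower (`|y| + 1) (ltr_wpDl (normr_ge0 _) ltr01).
have {}HM Psi u : (Psi = Phi \/ exists N, Psi = PhiN N) ->
    M - alpha1 * `|u| <= Psi u y by move=> h; apply: HM => //; rewrite ltrDl.
have Rint0 (f : X -> R) : 0 <= (\int[mu0]_v expR (f v))^-1.
  rewrite invr_ge0 /Rintegral fine_ge0//.
  by apply: integral_ge0 => u _; rewrite lee_fin expR_ge0.
(* Here [Z] and, below, [ZN] are the reciprocals of the normalising integrals. *)
have [Z Z0 {}hmu] : exists2 Z : R, 0 < Z &
    has_density mu mu0 (fun u : X => Z * expR (- Phi u y)).
  by eexists; [exact: has_density_scale_gt0 hmu (Rint0 _)|exact: hmu].
(* The exponent 2 C - M collects the part of alpha1 |u| - M + 2 (alpha3 |u| + C) that is free of u;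
   the rest is alpha |u|, integrated in [E]. *)
exists (Num.sqrt (Z * expR (2 * C - M) * fine E)) => N nu munu _.
have [ZN ZN0 hN] : exists2 ZN : R, 0 < ZN &
    has_density (muN N) mu0 (fun u : X => ZN * expR (- PhiN N u y)).
  by eexists; [exact: has_density_scale_gt0 (hmuN N) (Rint0 _)|exact: hmuN].
have [mumu0 muf] := hmu; have [muNmu0 muNf] := hN.
have mu0nu : mu0 `<< nu.
  apply: null_dominates_trans munu; apply: has_density_gt0_dominates hmu _ => u.
  by rewrite mulr_gt0 ?expR_gt0.
have -> : Num.sqrt (Z * expR (2 * C - M) * fine E) * rate N =
    Num.sqrt (Z * expR (2 * C - M) * fine E * rate N ^+ 2).
  rewrite [RHS]sqrtrM; first by rewrite sqrtr_sqr ger0_norm.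
  by rewrite mulr_ge0 ?fine_ge0// mulr_ge0 ?expR_ge0// ltW.
(* This multiple cancels [ZN], which keeps the constant independent of N. *)
have c0 : 0 <= Num.sqrt Z / Num.sqrt ZN by rewrite divr_ge0 ?sqrtr_ge0.
apply: (hellinger_le mu0nu mumu0 muNmu0 c0).
pose K := Z * expR (2 * C - M) * rate N ^+ 2.
have K0 : 0 <= K by rewrite mulr_ge0 ?sqr_ge0// mulr_ge0 ?expR_ge0// ltW.
apply: (@le_trans _ _ (\int[mu0]_u (K%:E * (expR (alpha * `|u : X|))%:E))%E); last first.
  rewrite ge0_integralZl//.
  by rewrite -/E -(fineK Efin) -EFinM lee_fin /K mulrAC.
have mRN (m : probability (borel X) R) : m `<< mu0 -> measurable_fun setT
    (fun u => Num.sqrt (fine (Radon_Nikodym (charge_of_finite_measure m) mu0 u))).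
  move=> mmu0; apply: (measurableT_comp (continuous_measurable_fun (@sqrt_continuous R))).
  by apply: measurableT_comp => //; exact: measurable_int (Radon_Nikodym_integrable _).
apply: ae_ge0_le_integral => //.
- by move=> u _; rewrite lee_fin sqr_ge0.
- apply/measurable_EFinP/measurable_funX/measurable_funB; first exact: mRN.
  by apply: measurable_funM => //; exact: mRN.
- by move=> u _; rewrite mule_ge0 ?lee_fin ?expR_ge0.
- exact: measurable_funeM.
apply: filterS2 muf muNf => u h h' _; rewrite h// h'//= -EFinM lee_fin.
rewrite (sqrtrM _ (ltW Z0)) (sqrtrM _ (ltW ZN0)) !sqrt_expR.
have -> : Num.sqrt Z * expR (- Phi u y / 2) -
    Num.sqrt Z / Num.sqrt ZN * (Num.sqrt ZN * expR (- PhiN N u y / 2)) =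
    Num.sqrt Z * (expR (- Phi u y / 2) - expR (- PhiN N u y / 2)).
  by field; rewrite gt_eqF// sqrtr_gt0.
rewrite exprMn (sqr_sqrtr (ltW Z0)).
(* M - alpha1 |u| is a common lower bound of both potentials at u, as the Lipschitz estimate
   requires. *)
have le1 : M - alpha1 * `|u : X| <= Phi u y by apply: HM; left.
have le2 : M - alpha1 * `|u : X| <= PhiN N u y by apply: HM; right; exists N.
rewrite /K -(mulrA (Z * _)) -(mulrA Z) ler_pM2l//.
apply: (le_trans (expR_half_sub_sqr_le le1 le2)).
have -> : expR (2 * C - M) * (rate N ^+ 2 * expR (alpha * `|u : X|)) =
    expR (- (M - alpha1 * `|u : X|)) * (expR (alpha3 * `|u : X| + C) * rate N) ^+ 2.
  rewrite exprMn -expRM_natl [rate N ^+ 2 * _]mulrC !mulrA -!expRD.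
  by congr (expR _ * _ * _); rewrite /alpha; lra.
rewrite ler_wpM2l ?expR_ge0// -real_normK ?num_real// lerXn2r ?nnegrE//.
by rewrite mulr_ge0 ?expR_ge0.
Qed.
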